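(* The sequences $(|B_{2n}|^{1/n})_{n\ge 1}$, $(|T_{2n-1}|^{1/n})_{n\ge 1}$ and $(|E_{2n}|^{1/n})_{n\ge 1}$ are all increasing. Furthermore, the sequences $$\left(\frac{|B_{2n+2}|^{1/(n+1)}}{|B_{2n}|^{1/n}}\right)_{n\ge 2},\qquad \left(\frac{|T_{2n+1}|^{1/(n+1)}}{|T_{2n-1}|^{1/n}}\right)_{n\ge 1},\qquad \left(\frac{|E_{2n+2}|^{1/(n+1)}}{|E_{2n}|^{1/n}}\right)_{n\ge 1}$$ are decreasing.
   Context: The Bernoulli numbers $B_0,B_1,B_2,\ldots$ are the rational numbers given by $B_0=1$ and $\sum_{k=0}^n\binom{n+1}{k}B_k=0$ for all $n\ge 1$; their exponential generating function is $\frac{z}{e^z-1}=\sum_{n=0}^\infty \frac{B_n z^n}{n!}$. The Tangent numbers $T_n$ and the Euler numbers $E_n$ are defined by the exponential generating functions $$\tan z=\sum_{k=0}^\infty(-1)^{k+1}\frac{T_{2k+1}z^{2k+1}}{(2k+1)!},\qquad \sec z=\sum_{k=0}^\infty (-1)^k\frac{E_{2k}z^{2k}}{(2k)!},$$ so that $T_{2k}=0$ and $E_{2k-1}=0$ for $k\ge 1$.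
   Formalization: The tangent ratio sequence is shown to decrease for n ≥ 2 instead of n ≥ 1, because with |T_1|, |T_3|, |T_5| = 1, 2, 16 its first two terms are 1.414… < 1.781…, so the claim fails at n = 1. *)

(* Defs.v *)
From Stdlib Require Import Factorial QArith Qreals Reals.
From Coquelicot Require Import Coquelicot.
Open Scope R_scope.

(* [Binomial.C] is qualified because Coquelicot uses [C] for the complex
   numbers; [sum_f_R0 f n] has the n + 1 terms f 0, ..., f n. *)
Definition is_bernoulli (B : nat -> Q) : Prop :=
  Q2R (B 0%nat) = 1 /\
  forall n : nat, (1 <= n)%nat ->
    sum_f_R0 (fun k => Binomial.C (n + 1) k * Q2R (B k)) n = 0.

(* The sign (-1)^(k+1) makes T_1 = -1, T_3 = 2, T_5 = -16, T_7 = 272.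
   T_0 is left unconstrained.  The ratios |T_(2n+1)|^(1/(n+1)) / |T_(2n-1)|^(1/n)
   are 2^(1/2) = 1.414.. at n = 1 and 16^(1/3) / 2^(1/2) = 1.781.. at n = 2: they
   decrease only from n = 2 on. *)
Definition is_tangent_numbers (T : nat -> R) : Prop :=
  (forall k : nat, (1 <= k)%nat -> T (2 * k)%nat = 0) /\
  locally 0 (fun z : R =>
    is_series
      (fun k : nat => (-1) ^ (k + 1) * T (2 * k + 1)%nat * z ^ (2 * k + 1)
                      / INR (fact (2 * k + 1)))
      (tan z)).

Definition is_euler_numbers (E : nat -> R) : Prop :=
  (forall k : nat, (1 <= k)%nat -> E (2 * k - 1)%nat = 0) /\
  locally 0 (fun z : R =>
    is_series
      (fun k : nat => (-1) ^ k * E (2 * k)%nat * z ^ (2 * k)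
                      / INR (fact (2 * k)))
      (/ cos z)).

(* |x|^(1/n); only meaningful for x <> 0 and n >= 1, since [Rpower 0 y] is the
   junk value 1. *)
Definition abs_root (n : nat) (x : R) : R := Rpower (Rabs x) (/ INR n).

Definition increasing_from (N : nat) (u : nat -> R) : Prop :=
  forall m n : nat, (N <= m)%nat -> (m < n)%nat -> u m < u n.

Definition decreasing_from (N : nat) (u : nat -> R) : Prop :=
  forall m n : nat, (N <= m)%nat -> (m < n)%nat -> u n < u m.

(* Main.v *)
Require Import Defs.
From Stdlib Require Import Factorial QArith Qreals Reals Lra Lia Wf_nat.
From Coquelicot Require Import Coquelicot.
Open Scope R_scope.

(** Each of the three sequences has the form [|a n| = F n * c ^ n * y n], where
    [F n] is [(2n)!] or [(2n-1)!], [c] is a constant and [y n] converges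
    geometrically fast to its limit.  Both assertions compare [ln |a n| / n] at
    neighbouring indices.  After clearing denominators they say that two
    expressions, [root_growth] and [root_concavity], linear in the logarithm of
    the sequence, are positive.  They do not see [c]; on the factorial they are
    bounded below by their value at the first index considered, because the
    second differences of [ln (F n)] are positive and decreasing; and
    [ln (y n)] can lower them by no more than a small constant.  This is
    [root_criterion], and it leaves one numerical inequality between logarithms
    of small integers for each sequence.

    For the Bernoulli and tangent numbers, [y n] is twice [zeta (2n)] and twice
    [lambda (2n)] (the sum over odd integers).  As the value of [c] does not
    matter, this needs no evaluation of zeta in terms of pi: the differential
    equations of [z / (exp z - 1)] and of [tan] give the numbers
    [|B_2n| / (2n)!] and [|T_(2n-1)| / (2n-1)!] quadratic recurrences
    ([bernoulli_even_coeff_rec], [tan_coeffs_rec]), and the doubled zeta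
    values satisfy the same recurrences ([node_zeta_convolution]), by
    rearranging a double sum and telescoping.  A solution is determined by its initial value, and two
    solutions differ by a geometric factor ([quadratic_rec_solution]).

    For the Euler numbers, [sec' = tan * sec] gives a linear recurrence for
    [|E_2n| / (2n)!] whose coefficients are the tangent coefficients just found.
    After division by [c ^ n] its coefficients are the values [lambda (2j)],
    which are [1] up to a geometrically small error; this forces the quotients
    to increase to a limit at most [4 / 3], again geometrically fast
    ([linear_rec_increments]). *)

(** * Monotonicity of roots through logarithms *)

(** With [phi k = ln (a k)], positivity of [root_growth phi n] says that
    [phi n / n] increases from [n] to [n + 1], and positivity of
    [root_concavity phi n] says that its increments decrease there.  Clearing
    denominators makes both expressions linear in [phi] and makes both vanish
    on [phi k = k * ln c]: geometric factors are invisible to them, while a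
    constant [k0] contributes only [- k0] and [- 2 * k0]. *)
Definition root_growth (phi : nat -> R) (n : nat) : R :=
  INR n * phi (S n) - INR (S n) * phi n.

Definition root_concavity (phi : nat -> R) (n : nat) : R :=
  2 * INR n * (INR n + 2) * phi (S n)
  - (INR n + 1) * (INR n + 2) * phi n
  - INR n * (INR n + 1) * phi (S (S n)).

Lemma increasing_from_step (N : nat) (u : nat -> R) :
  (forall n, (N <= n)%nat -> u n < u (S n)) -> increasing_from N u.
Proof.
  intros H m n Hm Hmn.
  induction Hmn as [|n Hmn IH].
  - now apply H.
  - apply Rlt_trans with (u n); [exact IH|]. apply H. lia.
Qed.

Lemma decreasing_from_step (N : nat) (u : nat -> R) :
  (forall n, (N <= n)%nat -> u (S n) < u n) -> decreasing_from N u.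
Proof.
  intros H m n Hm Hmn.
  induction Hmn as [|n Hmn IH].
  - now apply H.
  - apply Rlt_trans with (u n); [|exact IH]. apply H. lia.
Qed.

Lemma increasing_roots (N : nat) (a : nat -> R) :
  (1 <= N)%nat ->
  (forall n, (N <= n)%nat -> 0 < root_growth (fun k => ln (Rabs (a k))) n) ->
  increasing_from N (fun n => abs_root n (a n)).
Proof.
  intros HN H. apply increasing_from_step. intros n Hn.
  specialize (H n Hn). unfold root_growth in H. unfold abs_root, Rpower.
  apply exp_increasing.
  set (x := ln (Rabs (a n))) in *. set (y := ln (Rabs (a (S n)))) in *.
  assert (Hn0 : 0 < INR n) by (apply lt_0_INR; lia).
  rewrite S_INR in *.
  apply Rlt_0_minus.
  replace (/ (INR n + 1) * y - / INR n * x)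
    with ((INR n * y - (INR n + 1) * x) / (INR n * (INR n + 1))) by (field; lra).
  apply Rdiv_lt_0_compat; [lra|]. nra.
Qed.

Lemma decreasing_root_ratios (N : nat) (a : nat -> R) :
  (1 <= N)%nat ->
  (forall n, (N <= n)%nat -> 0 < root_concavity (fun k => ln (Rabs (a k))) n) ->
  decreasing_from N (fun n => abs_root (n + 1) (a (n + 1)%nat) / abs_root n (a n)).
Proof.
  intros HN H. apply decreasing_from_step. intros n Hn.
  specialize (H n Hn). unfold root_concavity in H. unfold abs_root, Rpower.
  rewrite !Nat.add_1_r.
  unfold Rdiv. rewrite <- !exp_Ropp, <- !exp_plus.
  apply exp_increasing.
  set (x := ln (Rabs (a n))) in *. set (y := ln (Rabs (a (S n)))) in *.
  set (z := ln (Rabs (a (S (S n))))) in *.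
  assert (Hn0 : 0 < INR n) by (apply lt_0_INR; lia).
  rewrite !S_INR in *.
  apply Rlt_0_minus.
  match goal with |- 0 < ?e =>
  replace e with ((2 * INR n * (INR n + 2) * y - (INR n + 1) * (INR n + 2) * x
                   - INR n * (INR n + 1) * z)
                  / (INR n * (INR n + 1) * (INR n + 2))) by (field; lra) end.
  apply Rdiv_lt_0_compat; [lra|]. apply Rmult_lt_0_compat; nra.
Qed.

Lemma root_concavity_le_growth (phi : nat -> R) (n : nat) :
  0 <= phi (S (S n)) - 2 * phi (S n) + phi n ->
  root_concavity phi n <= 2 * root_growth phi n.
Proof.
  intro H. unfold root_concavity, root_growth. rewrite S_INR.
  assert (Hn := pos_INR n).
  assert (0 <= INR n * (INR n + 1)) by nra.
  assert (0 <= (INR n * (INR n + 1)) * (phi (S (S n)) - 2 * phi (S n) + phi n))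
    by (apply Rmult_le_pos; lra).
  nra.
Qed.

(** The difference of the two sides is [(n + 1) * (n + 2)] times the decrease
    of the second difference of [phi]. *)
Lemma root_concavity_mono (phi : nat -> R) (n : nat) :
  phi (S (S (S n))) - 2 * phi (S (S n)) + phi (S n)
    <= phi (S (S n)) - 2 * phi (S n) + phi n ->
  root_concavity phi n <= root_concavity phi (S n).
Proof.
  intro H. unfold root_concavity. rewrite S_INR.
  assert (Hn := pos_INR n).
  assert (0 <= (INR n + 1) * (INR n + 2) *
    ((phi (S (S n)) - 2 * phi (S n) + phi n)
     - (phi (S (S (S n))) - 2 * phi (S (S n)) + phi (S n))))
    by (apply Rmult_le_pos; [nra|lra]).
  nra.
Qed.

Definition log_fact (r n : nat) : R := ln (INR (fact (2 * n - r))).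

Lemma log_fact_succ (r n : nat) : (r <= 2 * n)%nat ->
  log_fact r (S n)
  = log_fact r n + ln (INR (2 * n - r) + 1) + ln (INR (2 * n - r) + 2).
Proof.
  intro H. unfold log_fact.
  replace (2 * S n - r)%nat with (S (S (2 * n - r))) by lia.
  assert (Hk := pos_INR (2 * n - r)). set (k := (2 * n - r)%nat) in *.
  assert (Hf := INR_fact_lt_0 k).
  rewrite !fact_simpl, !mult_INR, !S_INR.
  rewrite !ln_mult; try lra; [|apply Rmult_lt_0_compat; lra].
  replace (INR k + 1 + 1) with (INR k + 2) by ring. ring.
Qed.

Lemma log_fact_second_diff (r n : nat) : (r <= 2 * n)%nat ->
  log_fact r (S (S n)) - 2 * log_fact r (S n) + log_fact r n
  = ln (INR (2 * n - r) + 3) + ln (INR (2 * n - r) + 4)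
    - ln (INR (2 * n - r) + 1) - ln (INR (2 * n - r) + 2).
Proof.
  intro H. rewrite (log_fact_succ r (S n)), (log_fact_succ r n) by lia.
  replace (2 * S n - r)%nat with (S (S (2 * n - r))) by lia.
  rewrite !S_INR.
  replace (INR (2 * n - r) + 1 + 1 + 1) with (INR (2 * n - r) + 3) by ring.
  replace (INR (2 * n - r) + 1 + 1 + 2) with (INR (2 * n - r) + 4) by ring.
  ring.
Qed.

Lemma ln_midpoint (x : R) : 0 < x -> ln x + ln (x + 4) <= 2 * ln (x + 2).
Proof.
  intro H. replace (2 * ln (x + 2)) with (ln (x + 2) + ln (x + 2)) by ring.
  rewrite <- !ln_mult by lra. apply ln_le; nra.
Qed.

Lemma log_fact_convex (r n : nat) : (r <= 2 * n)%nat ->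
  0 <= log_fact r (S (S n)) - 2 * log_fact r (S n) + log_fact r n.
Proof.
  intro H. rewrite log_fact_second_diff by lia.
  assert (Hk := pos_INR (2 * n - r)). set (k := INR (2 * n - r)) in *.
  assert (ln (k + 1) <= ln (k + 3)) by (apply ln_le; lra).
  assert (ln (k + 2) <= ln (k + 4)) by (apply ln_le; lra).
  lra.
Qed.

(** The second differences of [log_fact r] are logarithms of the ratios
    [(x + 2) * (x + 3) / (x * (x + 1))], which decrease with [x].  So a lower
    bound for the concavity of a logarithm of factorials at all [n >= N] needs
    only one numerical value, the one at [N]. *)
Lemma log_fact_concavity_ge (r N n : nat) : (r <= 2 * N)%nat -> (N <= n)%nat ->
  root_concavity (log_fact r) N <= root_concavity (log_fact r) n.
Proof.
  intros Hr Hn. induction Hn as [|n Hn IH]; [lra|].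
  apply Rle_trans with (1 := IH). apply root_concavity_mono.
  rewrite !log_fact_second_diff by lia.
  replace (2 * S n - r)%nat with (S (S (2 * n - r))) by lia.
  rewrite !S_INR. assert (Hk := pos_INR (2 * n - r)).
  set (k := INR (2 * n - r)) in *.
  assert (H1 := ln_midpoint (k + 1) ltac:(lra)).
  assert (H2 := ln_midpoint (k + 2) ltac:(lra)).
  replace (k + 1 + 1 + 1) with (k + 3) by ring.
  replace (k + 1 + 1 + 3) with (k + 5) by ring.
  replace (k + 1 + 1 + 2) with (k + 4) by ring.
  replace (k + 1 + 1 + 4) with (k + 6) by ring.
  replace (k + 1 + 4) with (k + 5) in H1 by ring.
  replace (k + 1 + 2) with (k + 3) in H1 by ring.
  replace (k + 2 + 4) with (k + 6) in H2 by ring.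
  replace (k + 2 + 2) with (k + 4) in H2 by ring.
  lra.
Qed.

(** The factor [c ^ n] has no effect, the factorial contributes at least its
    value at [N], and a slowly varying factor [y] can only lose [theta].  The
    growth is handled by the same numerical value as the concavity, because
    convexity makes twice the growth of [log_fact r] exceed its concavity. *)
Theorem root_criterion (a y : nat -> R) (r N : nat) (c theta : R) :
  (1 <= N)%nat -> (r <= 2 * N)%nat -> 0 < c ->
  (forall n, (N <= n)%nat -> 0 < y n) ->
  (forall n, (N <= n)%nat -> Rabs (a n) = INR (fact (2 * n - r)) * c ^ n * y n) ->
  theta < root_concavity (log_fact r) N ->
  (forall n, (N <= n)%nat -> - theta <= root_concavity (fun k => ln (y k)) n) ->
  (forall n, (N <= n)%nat -> - theta <= 2 * root_growth (fun k => ln (y k)) n) ->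
  increasing_from N (fun n => abs_root n (a n)) /\
  decreasing_from N (fun n => abs_root (n + 1) (a (n + 1)%nat) / abs_root n (a n)).
Proof.
  intros HN Hr Hc Hy Ha Htheta Hconc Hgrow.
  assert (Hln : forall n, (N <= n)%nat ->
            ln (Rabs (a n)) = log_fact r n + INR n * ln c + ln (y n)).
  { intros n Hn. rewrite Ha by exact Hn.
    assert (Hf := INR_fact_lt_0 (2 * n - r)).
    assert (Hp := pow_lt c n Hc). specialize (Hy n Hn).
    rewrite !ln_mult, ln_pow; auto. now apply Rmult_lt_0_compat. }
  assert (Hfact : forall n, (N <= n)%nat -> theta < root_concavity (log_fact r) n).
  { intros n Hn. assert (H := log_fact_concavity_ge r N n Hr Hn). lra. }
  split.
  - apply increasing_roots; [exact HN|]. intros n Hn.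
    specialize (Hgrow n Hn). specialize (Hfact n Hn).
    assert (H := root_concavity_le_growth (log_fact r) n
                   (log_fact_convex r n ltac:(lia))).
    unfold root_growth in *. rewrite !Hln by lia. rewrite !S_INR in *. nra.
  - apply decreasing_root_ratios; [exact HN|]. intros n Hn.
    specialize (Hconc n Hn). specialize (Hfact n Hn).
    unfold root_concavity in *. rewrite !Hln by lia. rewrite !S_INR in *. nra.
Qed.

(** * Convolutions of power sums *)

Lemma sum_exchange (f : nat -> nat -> R) (m n : nat) :
  sum_f_R0 (fun i => sum_f_R0 (f i) n) m
  = sum_f_R0 (fun j => sum_f_R0 (fun i => f i j) m) n.
Proof.
  induction m as [|m IH]; simpl; [reflexivity|].
  rewrite IH, <- sum_plus. apply sum_eq. reflexivity.
Qed.

Lemma sum_scal_l (c : R) (f : nat -> R) (n : nat) :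
  sum_f_R0 (fun i => c * f i) n = c * sum_f_R0 f n.
Proof. rewrite scal_sum. apply sum_eq. intros; ring. Qed.

Lemma sum_mult (f g : nat -> R) (m n : nat) :
  sum_f_R0 f m * sum_f_R0 g n
  = sum_f_R0 (fun i => sum_f_R0 (fun j => f i * g j) n) m.
Proof.
  rewrite Rmult_comm, scal_sum. apply sum_eq. intros i _.
  now rewrite sum_scal_l.
Qed.

Lemma sum_single (f : nat -> R) (i n : nat) : (i <= n)%nat ->
  sum_f_R0 (fun j => if Nat.eqb i j then f j else 0) n = f i.
Proof.
  assert (H0 : forall k, (k < i)%nat ->
    sum_f_R0 (fun j => if Nat.eqb i j then f j else 0) k = 0).
  { induction k as [|k IH]; intro Hk; simpl.
    - destruct (Nat.eqb_spec i 0); [lia|reflexivity].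
    - rewrite IH by lia. destruct (Nat.eqb_spec i (S k)); [lia|ring]. }
  intro H. induction H as [|n Hn IH].
  - destruct i as [|i]; simpl; [reflexivity|].
    rewrite H0 by lia. rewrite Nat.eqb_refl. ring.
  - simpl. rewrite IH. destruct (Nat.eqb_spec i (S n)); [lia|ring].
Qed.

Lemma geometric_convolution (x y : R) (m : nat) :
  sum_f_R0 (fun j => x ^ j * y ^ (m - j)) m * (x - y) = x ^ S m - y ^ S m.
Proof.
  induction m as [|m IH]; [simpl; ring|].
  rewrite tech5.
  rewrite (sum_eq _ (fun j => y * (x ^ j * y ^ (m - j)))).
  2:{ intros i Hi. replace (S m - i)%nat with (S (m - i)) by lia. simpl. ring. }
  rewrite sum_scal_l, Nat.sub_diag, Rmult_plus_distr_r, Rmult_assoc, IH.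
  simpl. ring.
Qed.

Lemma off_diagonal_kernel (x : nat -> R) (m M Q : nat) :
  (x M = x Q -> M = Q) ->
  sum_f_R0 (fun j => x M ^ S j * x Q ^ S (m - j)) m
  = x M ^ S m * (x M * x Q / (x M - x Q)) + x Q ^ S m * (x Q * x M / (x Q - x M))
    + (if Nat.eqb M Q then INR (S m) * x Q ^ S (S m) else 0).
Proof.
  intro Hinj.
  rewrite (sum_eq _ (fun j => x M * x Q * (x M ^ j * x Q ^ (m - j))))
    by (intros; simpl; ring).
  rewrite sum_scal_l.
  destruct (Nat.eqb_spec M Q) as [->|HMQ].
  -
    (* The quotients with zero denominator vanish because [/ 0 = 0]. *)
    unfold Rdiv. rewrite Rminus_diag, Rinv_0.
    rewrite (sum_eq _ (fun _ => x Q ^ m)).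
    2:{ intros i Hi. rewrite <- pow_add. f_equal. lia. }
    rewrite sum_cte. simpl. ring.
  - assert (Hd : x M - x Q <> 0) by (intro H; apply HMQ, Hinj; lra).
    apply Rmult_eq_reg_r with (x M - x Q); [|exact Hd].
    rewrite Rmult_assoc, geometric_convolution. simpl. field. lra.
Qed.

(** Convolving power sums produces, for each pair of nodes, a geometric sum in
    the two nodes.  The diagonal pairs give back a power sum; the geometric sum
    of an off-diagonal pair collapses to two terms, each a power of one node
    times the kernel [x M * x Q / (x M - x Q)].  For [M = Q] that kernel is [0],
    by the convention [/ 0 = 0], so it can be summed over all [Q]. *)
Lemma power_sum_convolution (x : nat -> R) (m N : nat) :
  (forall M Q, x M = x Q -> M = Q) ->
  let P j := sum_f_R0 (fun M => x M ^ S j) N in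
  PS_mult P P m
  = INR (S m) * P (S m)
    + 2 * sum_f_R0 (fun M => x M ^ S m *
            sum_f_R0 (fun Q => x M * x Q / (x M - x Q)) N) N.
Proof.
  intros Hinj P. unfold PS_mult.
  rewrite (sum_eq _ (fun j => sum_f_R0 (fun M => sum_f_R0 (fun Q =>
             x M ^ S j * x Q ^ S (m - j)) N) N)).
  2:{ intros j _. unfold P. apply sum_mult. }
  rewrite sum_exchange.
  rewrite (sum_eq _ (fun M => sum_f_R0 (fun Q =>
     x M ^ S m * (x M * x Q / (x M - x Q)) + x Q ^ S m * (x Q * x M / (x Q - x M))
     + (if Nat.eqb M Q then INR (S m) * x Q ^ S (S m) else 0)) N)).
  2:{ intros M _. rewrite sum_exchange. apply sum_eq. intros Q _.
      apply off_diagonal_kernel, Hinj. }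
  rewrite (sum_eq _ (fun M =>
     x M ^ S m * sum_f_R0 (fun Q => x M * x Q / (x M - x Q)) N
     + sum_f_R0 (fun Q => x Q ^ S m * (x Q * x M / (x Q - x M))) N
     + INR (S m) * x M ^ S (S m))).
  2:{ intros M HM. rewrite !sum_plus, sum_scal_l.
      now rewrite (sum_single (fun Q => INR (S m) * x Q ^ S (S m)) M N HM). }
  rewrite !sum_plus, sum_scal_l.
  rewrite (sum_exchange (fun M Q => x Q ^ S m * (x Q * x M / (x Q - x M)))).
  rewrite (sum_eq (fun j => sum_f_R0 (fun i => x j ^ S m * (x j * x i / (x j - x i))) N)
             (fun M => x M ^ S m * sum_f_R0 (fun Q => x M * x Q / (x M - x Q)) N))
    by (intros; apply sum_scal_l).
  unfold P. ring.
Qed.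

(** The term for [i = 0] is [/ 0 = 0]. *)
Definition harmonic (n : nat) : R := sum_f_R0 (fun i => / INR i) n.

Lemma harmonic_succ (n : nat) : harmonic (S n) = harmonic n + / INR (S n).
Proof. reflexivity. Qed.

Lemma sum_inv_shift (k N : nat) : (0 < k)%nat ->
  sum_f_R0 (fun Q => / (INR Q + INR k)) N = harmonic (N + k) - harmonic (k - 1).
Proof.
  intro Hk. induction N as [|N IH].
  - destruct k as [|k]; [lia|].
    replace (S k - 1)%nat with k by lia. rewrite Nat.add_0_l.
    rewrite harmonic_succ. cbn [sum_f_R0]. change (INR 0) with 0. rewrite Rplus_0_l. ring.
  - rewrite tech5, IH. rewrite Nat.add_succ_l, harmonic_succ.
    rewrite !S_INR, plus_INR.
    replace (INR N + 1 + INR k) with (INR N + INR k + 1) by ring. ring.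
Qed.

(** The undefined term [Q = M] is [/ 0 = 0], so this is the sum over
    [Q <> M]: the terms below [M] contribute [- harmonic M], those above
    it [harmonic (N - M)]. *)
Lemma sum_inv_diff (M N : nat) : (M <= N)%nat ->
  sum_f_R0 (fun Q => / (INR Q - INR M)) N = harmonic (N - M) - harmonic M.
Proof.
  assert (Hlow : forall k, (k < M)%nat ->
    sum_f_R0 (fun Q => / (INR Q - INR M)) k = harmonic (M - S k) - harmonic M).
  { induction k as [|k IH]; intro Hk.
    - destruct M as [|M]; [lia|]. rewrite harmonic_succ.
      replace (S M - 1)%nat with M by lia. cbn [sum_f_R0].
      change (INR 0) with 0. rewrite Rminus_0_l, Rinv_opp. ring.
    - rewrite tech5, IH by lia.
      replace (M - S k)%nat with (S (M - S (S k))) by lia.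
      rewrite harmonic_succ.
      replace (S (M - S (S k))) with (M - S k)%nat by lia.
      rewrite minus_INR by lia.
      replace (INR (S k) - INR M) with (- (INR M - INR (S k))) by ring.
      rewrite Rinv_opp. ring. }
  intro H. induction H as [|N HN IH].
  - rewrite Nat.sub_diag. unfold harmonic at 1. 
    destruct M as [|M].
    + unfold harmonic; simpl. rewrite Rminus_diag, Rinv_0. ring.
    + rewrite tech5, Hlow by lia. rewrite Rminus_diag, Nat.sub_diag.
      unfold harmonic at 1. simpl. rewrite Rinv_0. ring.
  - rewrite tech5, IH. replace (S N - M)%nat with (S (N - M)) by lia.
    rewrite harmonic_succ. replace (S (N - M)) with (S N - M)%nat by lia.
    rewrite minus_INR by lia. ring.
Qed.

Lemma harmonic_increment (n k : nat) :
  0 <= harmonic (n + k) - harmonic n <= INR k / (INR n + 1).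
Proof.
  assert (Hn := pos_INR n).
  induction k as [|k IH].
  - rewrite Nat.add_0_r. simpl. unfold Rdiv. lra.
  - rewrite Nat.add_succ_r, harmonic_succ.
    rewrite !S_INR, plus_INR. assert (Hk := pos_INR k).
    assert (0 < / (INR n + INR k + 1)) by (apply Rinv_0_lt_compat; lra).
    assert (/ (INR n + INR k + 1) <= / (INR n + 1)) by (apply Rinv_le_contravar; lra).
    unfold Rdiv in *. lra.
Qed.

Lemma sum_nonneg (f : nat -> R) (n : nat) :
  (forall i, (i <= n)%nat -> 0 <= f i) -> 0 <= sum_f_R0 f n.
Proof.
  intro H. rewrite <- (Rmult_0_l (INR (S n))), <- (sum_cte 0 n).
  now apply sum_Rle.
Qed.

(** * Even zeta values *)

(** The nodes are the inverse squares [1 / (M + 1) ^ 2] for [s = 2] and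
    [1 / (2 * M + 1) ^ 2] for [s = 1], so that their power sums are the even
    zeta values [zeta (2 * j)] and [lambda (2 * j)] (sum over odd integers). *)
Definition node (s M : nat) : R := (INR s / (2 * INR M + INR s)) ^ 2.

Lemma node_pos (s M : nat) : (0 < s)%nat -> 0 < node s M.
Proof.
  intro Hs. apply lt_0_INR in Hs. assert (HM := pos_INR M).
  unfold node. apply pow_lt. apply Rdiv_lt_0_compat; lra.
Qed.

Lemma node_inj (s M Q : nat) : (0 < s)%nat -> node s M = node s Q -> M = Q.
Proof.
  intros Hs H. apply lt_0_INR in Hs. assert (HM := pos_INR M).
  assert (HQ := pos_INR Q). unfold node in H.
  apply INR_eq.
  assert (Hpos : forall x, 0 <= x -> 0 < INR s / (2 * x + INR s)).
  { intros x Hx. apply Rdiv_lt_0_compat; lra. }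
  assert (HpM := Hpos _ HM). assert (HpQ := Hpos _ HQ).
  assert (E : INR s / (2 * INR M + INR s) = INR s / (2 * INR Q + INR s)) by nra.
  assert (E2 : INR s * (2 * INR Q + INR s) = INR s * (2 * INR M + INR s)).
  { apply (Rmult_eq_compat_r ((2 * INR M + INR s) * (2 * INR Q + INR s))) in E.
    field_simplify in E; lra. }
  nra.
Qed.

Lemma node_le_square (s M : nat) : s = 1%nat \/ s = 2%nat ->
  node s M <= / ((INR M + 1) * (INR M + 1)).
Proof.
  intro Hs. assert (HM := pos_INR M). unfold node.
  assert (H : 0 <= INR s / (2 * INR M + INR s) <= / (INR M + 1)).
  { destruct Hs as [-> | ->]; simpl INR; split.
    - apply Rlt_le, Rdiv_lt_0_compat; lra.
    - unfold Rdiv. rewrite Rmult_1_l. apply Rinv_le_contravar; lra.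
    - apply Rlt_le, Rdiv_lt_0_compat; lra.
    - right. field. lra. }
  rewrite Rinv_mult. simpl. rewrite Rmult_1_r.
  apply Rmult_le_compat; lra.
Qed.

Lemma node_le_1 (s M : nat) : (0 < s)%nat -> node s M <= 1.
Proof.
  intro Hs. apply lt_0_INR in Hs. assert (HM := pos_INR M). unfold node.
  rewrite <- (pow1 2). apply pow_incr. split.
  - apply Rlt_le, Rdiv_lt_0_compat; lra.
  - apply Rmult_le_reg_r with (2 * INR M + INR s); [lra|].
    field_simplify; lra.
Qed.

Lemma node_0 (s : nat) : (0 < s)%nat -> node s 0 = 1.
Proof.
  intro Hs. apply lt_0_INR in Hs. unfold node. simpl. field. lra.
Qed.

Lemma node_kernel (s M Q : nat) : (0 < s)%nat ->
  node s M * node s Q / (node s M - node s Q)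
  = INR s ^ 2 / (4 * (2 * INR M + INR s))
    * (/ (INR Q - INR M) - / (INR Q + INR (M + s))
       + if Nat.eqb M Q then / (INR Q + INR (M + s)) else 0).
Proof.
  intro Hs. assert (Hs' := lt_0_INR _ Hs). assert (HM := pos_INR M).
  assert (HQ := pos_INR Q). rewrite plus_INR.
  destruct (Nat.eqb_spec M Q) as [->|HMQ].
  - unfold Rdiv at 1. rewrite !Rminus_diag, Rinv_0. ring.
  - assert (Hd : INR Q - INR M <> 0)
      by (intro H; apply HMQ; symmetry; apply INR_eq; lra).
    unfold node.
    replace ((INR s / (2 * INR M + INR s)) ^ 2 - (INR s / (2 * INR Q + INR s)) ^ 2)
      with (INR s ^ 2 * (4 * (INR Q - INR M) * (INR Q + (INR M + INR s)))
            / ((2 * INR M + INR s) ^ 2 * (2 * INR Q + INR s) ^ 2)) by (field; lra).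
    field. repeat split; lra.
Qed.

(** By partial fractions the kernel is a difference of reciprocals of integers,
    and the sum telescopes down to harmonic numbers.  Here [s <= 2] matters:
    [harmonic (M + s - 1) - harmonic M] must be a multiple of the reciprocal of
    [2 * M + s], so that it combines into a multiple of [node s M]. *)
Lemma node_kernel_sum (s M N : nat) : s = 1%nat \/ s = 2%nat -> (M <= N)%nat ->
  sum_f_R0 (fun Q => node s M * node s Q / (node s M - node s Q)) N
  = (2 * INR s - 1) / 4 * node s M
    - INR s ^ 2 / (4 * (2 * INR M + INR s))
      * (harmonic (N - M + (2 * M + s)) - harmonic (N - M)).
Proof.
  intros Hs HMN. assert (Hs0 : (0 < s)%nat) by lia.
  rewrite (sum_eq _ _ _ (fun Q _ => node_kernel s M Q Hs0)).
  rewrite sum_scal_l, sum_plus, minus_sum.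
  rewrite (sum_single (fun Q => / (INR Q + INR (M + s))) M N HMN).
  rewrite sum_inv_shift, sum_inv_diff by lia.
  replace (N - M + (2 * M + s))%nat with (N + (M + s))%nat by lia.
  replace (M + s - 1)%nat with (M + (s - 1))%nat by lia.
  rewrite plus_INR. unfold node. assert (HM := pos_INR M).
  destruct Hs as [-> | ->].
  - change (1 - 1)%nat with 0%nat. rewrite Nat.add_0_r. simpl INR. field. lra.
  - change (2 - 1)%nat with 1%nat. rewrite (Nat.add_1_r M), harmonic_succ, (S_INR M).
    simpl (INR 2). field. lra.
Qed.

Lemma node_kernel_error (s M N : nat) : s = 1%nat \/ s = 2%nat -> (M <= N)%nat ->
  0 <= (2 * INR s - 1) / 4 * node s M
       - sum_f_R0 (fun Q => node s M * node s Q / (node s M - node s Q)) N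
    <= / (INR (N - M) + 1).
Proof.
  intros Hs HMN. rewrite node_kernel_sum by assumption.
  assert (HM := pos_INR M). assert (HNM := pos_INR (N - M)).
  assert (H := harmonic_increment (N - M) (2 * M + s)).
  set (d := harmonic (N - M + (2 * M + s)) - harmonic (N - M)) in *.
  assert (Hs1 : 1 <= INR s <= 2) by (destruct Hs as [-> | ->]; simpl; lra).
  rewrite plus_INR, mult_INR in H. simpl (INR 2) in H.
  replace (1 + 1) with 2 in H by ring.
  match goal with |- _ <= ?e <= _ =>
    replace e with (INR s ^ 2 / (4 * (2 * INR M + INR s)) * d) by ring end.
  assert (Hp : 0 < INR s ^ 2 / (4 * (2 * INR M + INR s))).
  { apply Rdiv_lt_0_compat; [apply pow_lt|]; lra. }
  split; [apply Rmult_le_pos; lra|].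
  apply Rle_trans with (INR s ^ 2 / (4 * (2 * INR M + INR s))
                        * ((2 * INR M + INR s) / (INR (N - M) + 1))).
  { apply Rmult_le_compat_l; lra. }
  replace (INR s ^ 2 / (4 * (2 * INR M + INR s)) * ((2 * INR M + INR s) / (INR (N - M) + 1)))
    with (INR s ^ 2 / 4 * / (INR (N - M) + 1)) by (field; lra).
  rewrite <- (Rmult_1_l (/ (INR (N - M) + 1))) at 2.
  apply Rmult_le_compat_r; [apply Rlt_le, Rinv_0_lt_compat; lra|]. nra.
Qed.

(** Comparison with the telescoping series of
    [s ^ 2 / ((2 * M + s - 1) * (2 * M + s + 1))]. *)
Lemma node_tail_sum (s N : nat) : (0 < s)%nat ->
  sum_f_R0 (node s) N <= 1 + INR s ^ 2 / (2 * (INR s + 1)).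
Proof.
  intro Hs. assert (Hs' := lt_0_INR _ Hs).
  apply Rle_trans with (1 + INR s ^ 2 / 2 * (/ (INR s + 1) - / (2 * INR N + INR s + 1))).
  - induction N as [|N IH].
    + simpl sum_f_R0. rewrite node_0 by exact Hs. simpl INR. right. field. lra.
    + rewrite tech5. apply Rle_trans with (1 := Rplus_le_compat_r _ _ _ IH).
      assert (HN := pos_INR N). unfold node. rewrite S_INR.
      assert ((INR s / (2 * (INR N + 1) + INR s)) ^ 2
        <= INR s ^ 2 / 2 * (/ (2 * INR N + INR s + 1)
                            - / (2 * (INR N + 1) + INR s + 1))).
      { replace (INR s ^ 2 / 2 * (/ (2 * INR N + INR s + 1)
                            - / (2 * (INR N + 1) + INR s + 1)))
          with (INR s ^ 2 * / ((2 * INR N + INR s + 1) * (2 * (INR N + 1) + INR s + 1)))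
          by (field; lra).
        unfold Rdiv. rewrite Rpow_mult_distr. apply Rmult_le_compat_l; [apply pow2_ge_0|].
        rewrite pow_inv. apply Rinv_le_contravar; nra. }
      lra.
  - assert (HN := pos_INR N).
    assert (0 < / (2 * INR N + INR s + 1)) by (apply Rinv_0_lt_compat; lra).
    assert (0 <= INR s ^ 2 / 2) by (assert (H2 := pow2_ge_0 (INR s)); lra).
    replace (INR s ^ 2 / (2 * (INR s + 1))) with (INR s ^ 2 / 2 * / (INR s + 1))
      by (field; lra).
    nra.
Qed.

(** [1 / ((M + 1) * (N - M + 1))] is a sum of two reciprocals divided by
    [N + 2]; this gains the decaying factor, and what remains is bounded by the
    convergent sum of [node 2] plus [N + 1] terms of size at most
    [1 / (N + 1)]. *)
Lemma node_error_sum (s N : nat) : s = 1%nat \/ s = 2%nat ->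
  sum_f_R0 (fun M => node s M * / (INR (N - M) + 1)) N <= 3 * / (INR N + 2).
Proof.
  intro Hs. assert (HN := pos_INR N).
  apply Rle_trans with
    (sum_f_R0 (fun M => / (INR N + 2) * (node 2 M + / (INR N + 1))) N).
  - apply sum_Rle. intros M HM.
    assert (HMR := pos_INR M). rewrite minus_INR by exact HM. apply le_INR in HM.
    apply Rle_trans with (/ ((INR M + 1) * (INR M + 1)) * / (INR N - INR M + 1)).
    { apply Rmult_le_compat_r; [apply Rlt_le, Rinv_0_lt_compat; lra|].
      now apply node_le_square. }
    replace (/ ((INR M + 1) * (INR M + 1)) * / (INR N - INR M + 1))
      with (/ (INR N + 2) * (/ ((INR M + 1) * (INR M + 1))
             + / ((INR M + 1) * (INR N - INR M + 1)))) by (field; lra).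
    apply Rmult_le_compat_l; [apply Rlt_le, Rinv_0_lt_compat; lra|].
    apply Rplus_le_compat.
    + right. unfold node. simpl INR. field. lra.
    + apply Rinv_le_contravar; nra.
  - rewrite sum_scal_l, Rmult_comm.
    apply Rmult_le_compat_r; [apply Rlt_le, Rinv_0_lt_compat; lra|].
    rewrite sum_plus, sum_cte, S_INR.
    replace (/ (INR N + 1) * (INR N + 1)) with 1 by (field; lra).
    assert (H := node_tail_sum 2 N ltac:(lia)). simpl INR in H. 
    change (fun l => node 2 l) with (node 2). lra.
Qed.

Definition node_power_sum (s j N : nat) : R := sum_f_R0 (fun M => node s M ^ S j) N.

(** This is [zeta (2 * j + 2)] for [s = 2] and [lambda (2 * j + 2)] for
    [s = 1]. *)
Definition node_zeta (s j : nat) : R := Series (fun M => node s M ^ S j).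

(** All terms but the first contain the factor [node s 1 ^ j], up to which they
    are the tail of the convergent sum of the nodes. *)
Lemma node_power_sum_bounds (s j N : nat) : (0 < s)%nat ->
  1 <= node_power_sum s j N
    <= 1 + INR s ^ 2 / (2 * (INR s + 1)) * node s 1 ^ j.
Proof.
  intro Hs. assert (Hs' := lt_0_INR _ Hs). unfold node_power_sum.
  assert (Hx := node_pos s 1 Hs). assert (Hxj := pow_lt _ j Hx).
  assert (H0 : node s 0 ^ S j = 1) by (now rewrite node_0, pow1).
  assert (Ht := node_tail_sum s N Hs).
  assert (Hmono : forall M, node s (S M) <= node s 1).
  { intro M. unfold node. rewrite S_INR. change (INR 1) with 1.
    assert (HM := pos_INR M). apply pow_incr. split.
    - apply Rlt_le, Rdiv_lt_0_compat; lra.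
    - apply Rmult_le_compat_l; [lra|]. apply Rinv_le_contravar; lra. }
  destruct N as [|N].
  - cbn [sum_f_R0] in *. rewrite H0. split; [lra|].
    assert (0 <= INR s ^ 2 / (2 * (INR s + 1)) * node s 1 ^ j); [|lra].
    apply Rmult_le_pos; [|lra].
    apply Rlt_le, Rdiv_lt_0_compat; [apply pow_lt|]; lra.
  - rewrite !decomp_sum in * by lia. rewrite H0, node_0 in * by exact Hs.
    simpl pred in *. split.
    + assert (0 <= sum_f_R0 (fun i => node s (S i) ^ S j) N); [|lra].
      apply cond_pos_sum. intro i. apply Rlt_le, pow_lt, node_pos, Hs.
    + apply Rplus_le_compat_l.
      apply Rle_trans with (sum_f_R0 (fun i => node s 1 ^ j * node s (S i)) N).
      * apply sum_Rle. intros M _. simpl. rewrite Rmult_comm.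
        assert (HM := node_pos s (S M) Hs).
        apply Rmult_le_compat_r; [lra|]. apply pow_incr. split; [lra|apply Hmono].
      * rewrite sum_scal_l, Rmult_comm. apply Rmult_le_compat_r; lra.
Qed.

Lemma is_lim_node_zeta (s j : nat) : (0 < s)%nat ->
  is_lim_seq (node_power_sum s j) (node_zeta s j).
Proof.
  intro Hs. unfold node_zeta, Series.
  rewrite (Lim_seq_ext _ (node_power_sum s j)) by (intro; apply sum_n_Reals).
  apply Lim_seq_correct'.
  apply ex_finite_lim_seq_incr with (1 + INR s ^ 2 / (2 * (INR s + 1)) * node s 1 ^ j).
  - intro N. unfold node_power_sum. rewrite tech5.
    assert (H := pow_lt _ (S j) (node_pos s (S N) Hs)). lra.
  - intro N. now apply node_power_sum_bounds.
Qed.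

Lemma node_zeta_ge_1 (s j : nat) : (0 < s)%nat -> 1 <= node_zeta s j.
Proof.
  intro Hs.
  apply (is_lim_seq_le (fun _ => 1) (node_power_sum s j) 1 (node_zeta s j)).
  - intro N. now apply node_power_sum_bounds.
  - apply is_lim_seq_const.
  - now apply is_lim_node_zeta.
Qed.

Lemma node_zeta_le (s j : nat) : (0 < s)%nat ->
  node_zeta s j <= 1 + INR s ^ 2 / (2 * (INR s + 1)) * node s 1 ^ j.
Proof.
  intro Hs.
  apply (is_lim_seq_le (node_power_sum s j)
           (fun _ => 1 + INR s ^ 2 / (2 * (INR s + 1)) * node s 1 ^ j)
           (node_zeta s j) (1 + INR s ^ 2 / (2 * (INR s + 1)) * node s 1 ^ j)).
  - intro N. now apply node_power_sum_bounds.
  - now apply is_lim_node_zeta.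
  - apply is_lim_seq_const.
Qed.

Lemma node_zeta_decreasing (s j : nat) : (0 < s)%nat ->
  node_zeta s (S j) <= node_zeta s j.
Proof.
  intro Hs.
  apply (is_lim_seq_le (node_power_sum s (S j)) (node_power_sum s j)
           (node_zeta s (S j)) (node_zeta s j)).
  - intro N. apply sum_Rle. intros M _.
    assert (H := pow_lt _ (S j) (node_pos s M Hs)).
    assert (H1 := node_le_1 s M Hs). change (node s M ^ S (S j)) with (node s M * node s M ^ S j).
    nra.
  - now apply is_lim_node_zeta.
  - now apply is_lim_node_zeta.
Qed.

Lemma is_lim_seq_sum (u : nat -> nat -> R) (l : nat -> R) (m : nat) :
  (forall j, is_lim_seq (u j) (l j)) ->
  is_lim_seq (fun N => sum_f_R0 (fun j => u j N) m) (sum_f_R0 l m).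
Proof.
  intro H. induction m as [|m IH]; simpl; [apply H|].
  apply (is_lim_seq_plus' _ _ _ _ IH (H (S m))).
Qed.

(** For [s = 2] this is Euler's identity
    [(2 * n + 1) * zeta (2 * n) = 2 * sum of zeta (2 * k) * zeta (2 * n - 2 * k)]
    with [n = m + 2], and [s = 1] is its analogue for the sum over odd
    integers, with [2 * n - 1] in place of [2 * n + 1].  It is the limit of
    [power_sum_convolution] for the first [N] nodes: the kernel sums tend to
    [(2 * s - 1) / 4 * node s M], and [err], the total effect of truncating
    them, is [O(1 / N)]. *)
Theorem node_zeta_convolution (s m : nat) : s = 1%nat \/ s = 2%nat ->
  2 * PS_mult (node_zeta s) (node_zeta s) m
  = INR (2 * m + 2 * s + 1) * node_zeta s (S m).
Proof.
  intro Hs. assert (Hs0 : (0 < s)%nat) by lia.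
  set (err := fun N => sum_f_R0 (fun M => node s M ^ S m *
     ((2 * INR s - 1) / 4 * node s M
      - sum_f_R0 (fun Q => node s M * node s Q / (node s M - node s Q)) N)) N).
  assert (Hfin : forall N,
    PS_mult (fun j => node_power_sum s j N) (fun j => node_power_sum s j N) m
    = (INR (2 * m + 2 * s + 1) / 2) * node_power_sum s (S m) N - 2 * err N).
  { intro N.
    assert (H := power_sum_convolution (node s) m N (fun M Q => node_inj s M Q Hs0)).
    cbv zeta in H. fold (node_power_sum s (S m) N) in H.
    unfold node_power_sum at 1 2. rewrite H. clear H.
    unfold err.
    rewrite (sum_eq (fun M => node s M ^ S m *
     ((2 * INR s - 1) / 4 * node s M
      - sum_f_R0 (fun Q => node s M * node s Q / (node s M - node s Q)) N))
      (fun M => (2 * INR s - 1) / 4 * node s M ^ S (S m)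
       - node s M ^ S m * sum_f_R0 (fun Q => node s M * node s Q / (node s M - node s Q)) N))
      by (intros; simpl; ring).
    rewrite minus_sum, sum_scal_l. fold (node_power_sum s (S m) N).
    rewrite !plus_INR, !mult_INR, S_INR. simpl (INR 2). simpl (INR 1). field. }
  set (k := INR (2 * m + 2 * s + 1)) in *.
  assert (Herr : is_lim_seq err 0).
  { apply is_lim_seq_le_le with (fun _ => 0) (fun N => 3 * / (INR N + 2)).
    - intro N. split.
      + apply sum_nonneg. intros M HM. apply Rmult_le_pos.
        * apply Rlt_le, pow_lt, node_pos, Hs0.
        * now apply node_kernel_error.
      + apply Rle_trans with (2 := node_error_sum s N Hs).
        apply sum_Rle. intros M HM.
        assert (H := node_kernel_error s M N Hs HM).
        assert (Hp := node_pos s M Hs0). assert (H1 := node_le_1 s M Hs0).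
        assert (Hpm := pow_lt _ m Hp).
        apply Rmult_le_compat; try apply H; simpl.
        * apply Rmult_le_pos; lra.
        * assert (node s M ^ m <= 1); [|nra].
          rewrite <- (pow1 m). apply pow_incr. lra.
    - apply is_lim_seq_const.
    - replace (Finite 0) with (Rbar_mult 3 (Rbar_inv p_infty)) by (simpl; f_equal; ring).
      apply is_lim_seq_scal_l. apply is_lim_seq_inv; [|discriminate].
      apply is_lim_seq_plus with p_infty 2;
        [apply is_lim_seq_INR|apply is_lim_seq_const|reflexivity]. }
  assert (Hl : is_lim_seq
    (fun N => PS_mult (fun j => node_power_sum s j N) (fun j => node_power_sum s j N) m)
    (PS_mult (node_zeta s) (node_zeta s) m)).
  { unfold PS_mult.
    apply (is_lim_seq_sum (fun j N => node_power_sum s j N * node_power_sum s (m - j) N)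
             (fun j => node_zeta s j * node_zeta s (m - j))).
    intro j. apply is_lim_seq_mult'; now apply is_lim_node_zeta. }
  assert (Hr : is_lim_seq
    (fun N => PS_mult (fun j => node_power_sum s j N) (fun j => node_power_sum s j N) m)
    (k / 2 * node_zeta s (S m) - 2 * 0)).
  { apply is_lim_seq_ext with
      (fun N => k / 2 * node_power_sum s (S m) N - 2 * err N).
    - intro N. symmetry. apply Hfin.
    - apply is_lim_seq_minus'; apply (is_lim_seq_scal_l _ _ (Finite _)).
      + now apply is_lim_node_zeta.
      + exact Herr. }
  apply is_lim_seq_unique in Hl. apply is_lim_seq_unique in Hr.
  rewrite Hl in Hr. injection Hr as Hr. rewrite Hr. field.
Qed.

(** * Taylor expansions at the origin *)

(** Asking for convergence to [f] near [0], and not only for equality of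
    [PSeries a] with [f], makes the positivity of the radius of convergence a
    consequence ([expands_radius]). *)
Definition expands (f : R -> R) (a : nat -> R) : Prop :=
  locally 0 (fun z : R => is_pseries a z (f z)).

Lemma expands_radius (f : R -> R) (a : nat -> R) :
  expands f a -> Rbar_lt 0 (CV_radius a).
Proof.
  intros [eps H].
  assert (He := cond_pos eps).
  assert (Hz : is_pseries a (eps / 2) (f (eps / 2))).
  { apply H. unfold ball; simpl. unfold AbsRing_ball, abs, minus, plus, opp; simpl.
    rewrite Ropp_0, Rplus_0_r, Rabs_pos_eq; lra. }
  destruct (Rbar_le_lt_dec (eps / 2) (CV_radius a)) as [Hle|Hlt].
  - apply Rbar_lt_le_trans with (2 := Hle). simpl. lra.
  - exfalso. apply (CV_disk_outside a (eps / 2)).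
    + rewrite Rabs_pos_eq by lra. exact Hlt.
    + apply ex_series_lim_0. apply ex_pseries_R. now exists (f (eps / 2)).
Qed.

Lemma locally_0_Rbar (r : Rbar) : Rbar_lt 0 r ->
  locally 0 (fun z : R => Rbar_lt (Rabs z) r).
Proof.
  intro Hr.
  assert (Hd : exists d : posreal, Rbar_le d r).
  { destruct r as [r| |].
    - exists (mkposreal r Hr). simpl. lra.
    - now exists (mkposreal 1 Rlt_0_1).
    - destruct Hr. }
  destruct Hd as [d Hd]. exists d. intros z Hz.
  apply Rbar_lt_le_trans with (2 := Hd). simpl.
  unfold ball in Hz; simpl in Hz. unfold AbsRing_ball, abs, minus, plus, opp in Hz; simpl in Hz.
  now rewrite Ropp_0, Rplus_0_r in Hz.
Qed.

Lemma expands_PSeries (a : nat -> R) :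
  Rbar_lt 0 (CV_radius a) -> expands (PSeries a) a.
Proof.
  intro Hr. unfold expands. generalize (locally_0_Rbar _ Hr). apply filter_imp.
  intros z Hz. now apply PSeries_correct, CV_radius_inside.
Qed.

Lemma expands_unique (f : R -> R) (a b : nat -> R) (n : nat) :
  expands f a -> expands f b -> a n = b n.
Proof.
  intros Ha Hb. apply PSeries_ext_recip.
  - exact (expands_radius f a Ha).
  - exact (expands_radius f b Hb).
  - unfold expands in *. generalize (filter_and _ _ Ha Hb). apply filter_imp. intros z [H1 H2].
    now rewrite (is_pseries_unique _ _ _ H1), (is_pseries_unique _ _ _ H2).
Qed.

Lemma expands_ext (f g : R -> R) (a : nat -> R) :
  locally 0 (fun z : R => f z = g z) -> expands f a -> expands g a.
Proof.
  intros Hfg Ha. unfold expands in *. generalize (filter_and _ _ Hfg Ha). apply filter_imp.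
  now intros z [<- H].
Qed.

Lemma expands_plus (f g : R -> R) (a b : nat -> R) :
  expands f a -> expands g b -> expands (fun z => f z + g z) (PS_plus a b).
Proof.
  intros Ha Hb. unfold expands in *. generalize (filter_and _ _ Ha Hb). apply filter_imp.
  intros z [H1 H2]. exact (is_pseries_plus _ _ _ _ _ H1 H2).
Qed.

Lemma expands_minus (f g : R -> R) (a b : nat -> R) :
  expands f a -> expands g b -> expands (fun z => f z - g z) (PS_minus a b).
Proof.
  intros Ha Hb. unfold expands in *. generalize (filter_and _ _ Ha Hb). apply filter_imp.
  intros z [H1 H2]. exact (is_pseries_minus _ _ _ _ _ H1 H2).
Qed.

Lemma expands_mult (f g : R -> R) (a b : nat -> R) :
  expands f a -> expands g b -> expands (fun z => f z * g z) (PS_mult a b).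
Proof.
  intros Ha Hb.
  generalize (filter_and _ _ (filter_and _ _ Ha Hb)
    (filter_and _ _ (locally_0_Rbar _ (expands_radius f a Ha))
                    (locally_0_Rbar _ (expands_radius g b Hb)))).
  unfold expands. apply filter_imp. intros z [[H1 H2] [H3 H4]]. now apply is_pseries_mult.
Qed.

Lemma expands_incr (f : R -> R) (a : nat -> R) :
  expands f a -> expands (fun z => z * f z) (PS_incr_1 a).
Proof.
  unfold expands. apply filter_imp. intros z H. exact (is_pseries_incr_1 _ _ _ H).
Qed.

Lemma expands_one : expands (fun _ => 1) (fun n => match n with 0%nat => 1 | _ => 0 end).
Proof.
  unfold expands. apply filter_forall. intro z. apply is_pseries_R.
  apply filterlim_ext with (fun _ : nat => 1); [|apply filterlim_const].
  induction x as [|x IH].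
  - rewrite sum_O. simpl. ring.
  - rewrite sum_Sn, <- IH. unfold plus; simpl. ring.
Qed.

Lemma expands_derive (f f' : R -> R) (a : nat -> R) :
  expands f a -> locally 0 (fun z : R => is_derive f z (f' z)) ->
  expands f' (PS_derive a).
Proof.
  intros Ha Hd.
  generalize (filter_and _ _ (filter_and _ _ (locally_locally _ _ Ha) Hd)
    (locally_0_Rbar _ (expands_radius f a Ha))).
  unfold expands. apply filter_imp. intros z [[H1 H2] H3].
  replace (f' z) with (Derive (PSeries a) z); [now apply is_pseries_derive|].
  rewrite <- (is_derive_unique _ _ _ H2). apply Derive_ext_loc.
  generalize H1. apply filter_imp. intros t. apply is_pseries_unique.
Qed.

(** * Tangent and secant coefficients *)

Lemma sum_even_support (f : nat -> R) (m : nat) :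
  (forall j, f (2 * j + 1)%nat = 0) ->
  sum_f_R0 f (2 * m) = sum_f_R0 (fun j => f (2 * j)%nat) m.
Proof.
  intro H. induction m as [|m IH]; [reflexivity|].
  replace (2 * S m)%nat with (S (S (2 * m))) by lia. rewrite !tech5, IH.
  replace (S (2 * m)) with (2 * m + 1)%nat by lia. rewrite H.
  replace (S (2 * m + 1)) with (2 * S m)%nat by lia. ring.
Qed.

Lemma sum_odd_support (f : nat -> R) (m : nat) :
  (forall j, f (2 * j)%nat = 0) ->
  sum_f_R0 f (2 * m + 1) = sum_f_R0 (fun j => f (2 * j + 1)%nat) m.
Proof.
  intro H. induction m as [|m IH].
  - simpl. generalize (H 0%nat). simpl. lra.
  - replace (2 * S m + 1)%nat with (S (S (2 * m + 1))) by lia.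
    rewrite !tech5, IH.
    replace (S (2 * m + 1)) with (2 * S m)%nat by lia. rewrite H.
    replace (S (2 * S m)) with (2 * S m + 1)%nat by lia. ring.
Qed.

Definition odd_coeffs (c : nat -> R) (n : nat) : R :=
  if Nat.odd n then c (Nat.div2 n) else 0.

Definition even_coeffs (c : nat -> R) (n : nat) : R :=
  if Nat.even n then c (Nat.div2 n) else 0.

Lemma odd_coeffs_even (c : nat -> R) (k : nat) : odd_coeffs c (2 * k) = 0.
Proof. unfold odd_coeffs. now rewrite Nat.odd_even. Qed.

Lemma odd_coeffs_odd (c : nat -> R) (k : nat) : odd_coeffs c (2 * k + 1) = c k.
Proof.
  unfold odd_coeffs. rewrite Nat.odd_odd. 
  now rewrite Nat.add_1_r, Nat.div2_succ_double.
Qed.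

Lemma even_coeffs_even (c : nat -> R) (k : nat) : even_coeffs c (2 * k) = c k.
Proof. unfold even_coeffs. now rewrite Nat.even_even, Nat.div2_double. Qed.

Lemma even_coeffs_odd (c : nat -> R) (k : nat) : even_coeffs c (2 * k + 1) = 0.
Proof. unfold even_coeffs. now rewrite Nat.even_odd. Qed.

Lemma is_series_0 : is_series (fun _ : nat => 0) 0.
Proof.
  apply filterlim_ext with (fun _ : nat => 0); [|apply filterlim_const].
  induction x as [|x IH].
  - now rewrite sum_O.
  - rewrite sum_Sn, <- IH. unfold plus; simpl. ring.
Qed.

Lemma is_pseries_0_coeffs (a : nat -> R) (z : R) :
  (forall n, a n = 0) -> is_pseries a z 0.
Proof.
  intro H. apply is_pseries_R. apply is_series_ext with (2 := is_series_0).
  intro n. rewrite H. symmetry. apply Rmult_0_l.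
Qed.

Lemma expands_even (c : nat -> R) (f : R -> R) :
  locally 0 (fun z : R => is_series (fun k => c k * z ^ (2 * k)) (f z)) ->
  expands f (even_coeffs c).
Proof.
  unfold expands. apply filter_imp. intros z H.
  replace (f z) with (f z + z * 0) by ring.
  apply is_pseries_odd_even.
  - apply is_pseries_R. apply is_series_ext with (2 := H).
    intro n. rewrite even_coeffs_even, pow_mult. reflexivity.
  - apply is_pseries_0_coeffs. intro n. apply even_coeffs_odd.
Qed.

Lemma expands_odd (c : nat -> R) (f : R -> R) :
  locally 0 (fun z : R => is_series (fun k => c k * z ^ (2 * k + 1)) (f z)) ->
  expands f (odd_coeffs c).
Proof.
  unfold expands. apply filter_imp. intros z H.
  destruct (Req_dec z 0) as [->|Hz].
  - replace (f 0) with (odd_coeffs c 0).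
    + exact (is_pseries_0 (odd_coeffs c)).
    + change (odd_coeffs c 0) with 0.
      apply (is_series_unique _ _) in H. rewrite <- H.
      symmetry. apply is_series_unique.
      apply is_series_ext with (2 := is_series_0).
      intro n. rewrite Nat.add_1_r. simpl. ring.
  - replace (f z) with (0 + z * (/ z * f z)) by (field; exact Hz).
    apply is_pseries_odd_even.
    + apply is_pseries_0_coeffs. intro n. apply odd_coeffs_even.
    + apply is_pseries_R.
      apply is_series_ext with (fun k => / z * (c k * z ^ (2 * k + 1))).
      * intro n.
        change (/ z * (c n * z ^ (2 * n + 1)) = odd_coeffs c (2 * n + 1) * (z ^ 2) ^ n).
        rewrite odd_coeffs_odd, pow_add, pow_mult. field. exact Hz.
      * apply (is_series_scal (/ z)) in H. exact H.
Qed.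

Lemma locally_cos_neq_0 : locally 0 (fun z : R => cos z <> 0).
Proof.
  exists (mkposreal 1 Rlt_0_1). intros z Hz.
  unfold ball in Hz; simpl in Hz.
  unfold AbsRing_ball, abs, minus, plus, opp in Hz; simpl in Hz.
  rewrite Ropp_0, Rplus_0_r in Hz. apply Rabs_def2 in Hz.
  assert (H := PI2_1). apply Rgt_not_eq, cos_gt_0; lra.
Qed.

(** Coefficients of [tan' = 1 + tan ^ 2]. *)
Lemma tan_coeffs_rec (w : nat -> R) :
  expands tan (odd_coeffs w) ->
  w 0%nat = 1 /\
  forall m, INR (2 * m + 3) * w (S m) = PS_mult w w m.
Proof.
  intro Hw.
  assert (Hrec : forall n, PS_derive (odd_coeffs w) n
    = PS_plus (PS_mult (odd_coeffs w) (odd_coeffs w))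
              (fun n => match n with 0%nat => 1 | _ => 0 end) n).
  { intro n. apply (expands_unique (fun z => tan z * tan z + 1)).
    - apply expands_derive with (f := tan); [exact Hw|].
      generalize locally_cos_neq_0. apply filter_imp. intros z Hz.
      replace (tan z * tan z + 1) with (tan z ^ 2 + 1) by ring.
      now apply is_derive_tan.
    - apply expands_plus; [|apply expands_one]. now apply expands_mult. }
  split.
  - generalize (Hrec 0%nat). unfold PS_derive, PS_plus, PS_mult, plus; simpl.
    unfold odd_coeffs; simpl. lra.
  - intro m. generalize (Hrec (2 * m + 2)%nat).
    unfold PS_derive, PS_plus, plus; simpl plus.
    replace (S (2 * m + 2)) with (2 * S m + 1)%nat by lia.
    rewrite odd_coeffs_odd. unfold PS_mult.
    replace (2 * m + 2)%nat with (S (2 * m + 1)) by lia.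
    rewrite tech5.
    replace (S (2 * m + 1)) with (2 * S m)%nat by lia.
    rewrite odd_coeffs_even, Rmult_0_l, Rplus_0_r.
    rewrite sum_odd_support by (intro; rewrite odd_coeffs_even; ring).
    replace (2 * S m + 1)%nat with (2 * m + 3)%nat by lia.
    simpl (match (2 * S m)%nat with 0%nat => _ | _ => _ end).
    intro H. rewrite H. clear H.
    replace (2 * S m)%nat with (S (S (2 * m))) by lia.
    rewrite Rplus_0_r. apply sum_eq. intros j Hj.
    rewrite odd_coeffs_odd. f_equal.
    replace (S (S (2 * m)) - (2 * j + 1))%nat with (2 * (m - j) + 1)%nat by lia.
    apply odd_coeffs_odd.
Qed.

(** Coefficients of [sec' = tan * sec]. *)
Lemma sec_coeffs_rec (w e : nat -> R) :
  expands tan (odd_coeffs w) -> expands (fun z => / cos z) (even_coeffs e) ->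
  e 0%nat = 1 /\
  forall m, INR (2 * m + 2) * e (S m) = PS_mult w e m.
Proof.
  intros Hw He. split.
  - assert (H := locally_singleton _ _ He). 
    assert (H0 := is_pseries_0 (even_coeffs e)).
    apply is_pseries_unique in H. apply is_pseries_unique in H0.
    change (even_coeffs e 0) with (e 0%nat) in H0.
    rewrite <- H0. change zero with 0. rewrite H, cos_0. field.
  - intro m.
    assert (Hrec : PS_derive (even_coeffs e) (2 * m + 1)
      = PS_mult (odd_coeffs w) (even_coeffs e) (2 * m + 1)).
    { apply (expands_unique (fun z => tan z * / cos z)).
      - apply expands_derive with (f := fun z => / cos z); [exact He|].
        generalize locally_cos_neq_0. apply filter_imp. intros z Hz.
        auto_derive; [exact Hz|]. unfold tan. field. exact Hz.
      - now apply expands_mult. }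
    revert Hrec. unfold PS_derive, PS_mult.
    replace (S (2 * m + 1)) with (2 * S m)%nat by lia.
    rewrite even_coeffs_even.
    rewrite sum_odd_support by (intro; rewrite odd_coeffs_even; ring).
    replace (2 * S m)%nat with (2 * m + 2)%nat by lia.
    intro H. rewrite H. apply sum_eq. intros j Hj.
    rewrite odd_coeffs_odd. f_equal.
    replace (2 * m + 1 - (2 * j + 1))%nat with (2 * (m - j))%nat by lia.
    apply even_coeffs_even.
Qed.

(** * The Bernoulli generating function *)

Definition bernoulli_coeff (B : nat -> Q) (n : nat) : R :=
  Q2R (B n) / INR (fact n).

(** Taylor coefficients of [(exp z - 1) / z]. *)
Definition expm1_coeff (n : nat) : R := / INR (fact (S n)).

Lemma bernoulli_inverse (B : nat -> Q) (n : nat) : is_bernoulli B ->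
  PS_mult (bernoulli_coeff B) expm1_coeff n
  = match n with 0%nat => 1 | _ => 0 end.
Proof.
  intros [H0 Hrec]. unfold PS_mult, bernoulli_coeff, expm1_coeff.
  destruct n as [|n].
  - simpl. rewrite H0. field.
  - specialize (Hrec (S n) ltac:(lia)).
    assert (Hf := INR_fact_neq_0 (S n + 1)).
    apply Rmult_eq_reg_l with (INR (fact (S n + 1))); [|exact Hf].
    rewrite Rmult_0_r, <- Hrec, <- sum_scal_l. apply sum_eq. intros k Hk.
    unfold Binomial.C. replace (S n + 1 - k)%nat with (S (S n - k)) by lia.
    assert (H1 := INR_fact_neq_0 k). assert (H2 := INR_fact_neq_0 (S (S n - k))).
    field. now split.
Qed.

Lemma pow2_le_fact (n : nat) : 2 ^ n <= INR (fact (S n)).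
Proof.
  induction n as [|n IH]; [simpl; lra|].
  rewrite fact_simpl, mult_INR, !S_INR. assert (Hn := pos_INR n).
  assert (Hp := pow_lt 2 n ltac:(lra)). simpl pow. nra.
Qed.

Lemma expm1_coeff_le (n : nat) : 0 <= expm1_coeff n <= (/ 2) ^ n.
Proof.
  unfold expm1_coeff. split.
  - apply Rlt_le, Rinv_0_lt_compat, INR_fact_lt_0.
  - rewrite pow_inv. apply Rinv_le_contravar; [apply pow_lt; lra|].
    apply pow2_le_fact.
Qed.

Lemma sum_half_powers (n : nat) : sum_f_R0 (fun k => (/ 2) ^ (S n - k)) n <= 1.
Proof.
  induction n as [|n IH]; [simpl; lra|].
  rewrite tech5, (sum_eq _ (fun k => / 2 * (/ 2) ^ (S n - k))).
  - rewrite sum_scal_l. replace (S (S n) - S n)%nat with 1%nat by lia. lra.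
  - intros k Hk. replace (S (S n) - k)%nat with (S (S n - k)) by lia. reflexivity.
Qed.

(** The recurrence expresses each coefficient as a combination of the previous
    ones, with weights [1 / (j + 1)! <= 2 ^ - j] of total at most [1].  A crude
    bound is enough: it only serves to give the generating function a positive
    radius of convergence. *)
Lemma bernoulli_coeff_bounded (B : nat -> Q) (n : nat) : is_bernoulli B ->
  Rabs (bernoulli_coeff B n) <= 1.
Proof.
  intro HB. induction n as [n IH] using lt_wf_ind.
  destruct n as [|n].
  - unfold bernoulli_coeff. destruct HB as [-> _]. simpl.
    unfold Rdiv. rewrite Rinv_1, Rmult_1_r, Rabs_R1. lra.
  - assert (H := bernoulli_inverse B (S n) HB). unfold PS_mult in H.
    rewrite tech5, Nat.sub_diag in H.
    change (expm1_coeff 0) with (/ 1) in H. rewrite Rinv_1, Rmult_1_r in H.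
    replace (bernoulli_coeff B (S n)) with
      (- sum_f_R0 (fun k => bernoulli_coeff B k * expm1_coeff (S n - k)) n) by lra.
    rewrite Rabs_Ropp. apply Rle_trans with (1 := Rsum_abs _ _).
    apply Rle_trans with (2 := sum_half_powers n). apply sum_Rle. intros k Hk.
    rewrite Rabs_mult. assert (He := expm1_coeff_le (S n - k)).
    rewrite (Rabs_pos_eq (expm1_coeff _)) by apply He.
    rewrite <- (Rmult_1_l ((/ 2) ^ _)).
    apply Rmult_le_compat; [apply Rabs_pos|apply He| |apply He].
    apply IH. lia.
Qed.

Lemma radius_of_bounded (a : nat -> R) :
  (forall n, Rabs (a n) <= 1) -> Rbar_lt 0 (CV_radius a).
Proof.
  intro H. apply Rbar_lt_le_trans with 1; [simpl; lra|].
  apply (proj1 (CV_radius_bounded a)). exists 1. intro n.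
  now rewrite pow1, Rmult_1_r.
Qed.

(** The generating function [G = z / (exp z - 1)] satisfies
    [z * G' = G - z * G - G ^ 2]; these are its coefficients.  They
    follow from [G * E = 1] and [z * E' = 1 + z * E - E], where
    [E = (exp z - 1) / z]. *)
Lemma bernoulli_riccati (B : nat -> Q) (n : nat) : is_bernoulli B ->
  let g := bernoulli_coeff B in
  INR (S n) * g (S n) = g (S n) - g n - PS_mult g g (S n).
Proof.
  intros HB g.
  set (e := expm1_coeff).
  assert (Hg : expands (PSeries g) g).
  { apply expands_PSeries, radius_of_bounded. intro. now apply bernoulli_coeff_bounded. }
  assert (He : expands (PSeries e) e).
  { apply expands_PSeries, radius_of_bounded. intro k.
    assert (H := expm1_coeff_le k). unfold e. rewrite Rabs_pos_eq by apply H.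
    apply Rle_trans with (1 := proj2 H).
    rewrite <- (pow1 k). apply pow_incr. lra. }
  assert (Hone : locally 0 (fun z : R => PSeries g z * PSeries e z = 1)).
  { generalize (filter_and _ _ (expands_mult _ _ _ _ Hg He) expands_one).
    apply filter_imp. intros z [H1 H2].
    rewrite <- (is_pseries_unique _ _ _ H1), <- (is_pseries_unique _ _ _ H2).
    apply PSeries_ext. intro k. now apply bernoulli_inverse. }
  assert (HE' : locally 0 (fun z : R =>
     z * PSeries (PS_derive e) z = 1 + z * PSeries e z - PSeries e z)).
  { assert (H1 := expands_derive _ (PSeries (PS_derive e)) _ He
      ltac:(generalize (locally_0_Rbar _ (expands_radius _ _ He)); apply filter_imp;
            intros z Hz; now apply is_derive_PSeries)).
    apply expands_incr in H1.
    assert (H2 := expands_minus _ _ _ _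
      (expands_plus _ _ _ _ expands_one (expands_incr _ _ He)) He).
    generalize (filter_and _ _ H1 H2). apply filter_imp. intros z [H3 H4].
    rewrite <- (is_pseries_unique _ _ _ H3), <- (is_pseries_unique _ _ _ H4).
    apply PSeries_ext. intro k.
    unfold PS_minus, PS_plus, PS_opp, PS_incr_1, PS_derive, e, expm1_coeff.
    unfold plus, opp; simpl plus; simpl opp.
    destruct k as [|k].
    - change (@zero R_NormedModule) with 0. simpl. field.
    - assert (Hf := INR_fact_neq_0 (S k)). rewrite (fact_simpl (S k)), mult_INR.
      rewrite !S_INR. assert (Hk := pos_INR k).
      change ((INR k + 1) * / ((INR k + 1 + 1) * INR (fact (S k)))
        = 0 + / INR (fact (S k)) + - / ((INR k + 1 + 1) * INR (fact (S k)))).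
      field. split; [exact Hf|lra]. }
  assert (Hfun : locally 0 (fun z : R =>
     z * PSeries (PS_derive g) z
     = PSeries g z - z * PSeries g z - PSeries g z * PSeries g z)).
  { generalize (filter_and _ _ (filter_and _ _ (locally_locally _ _ Hone) HE')
      (filter_and _ _ (locally_0_Rbar _ (expands_radius _ _ Hg))
                      (locally_0_Rbar _ (expands_radius _ _ He)))).
    apply filter_imp. intros z [[H1 H2] [H3 H4]].
    assert (HD := is_derive_mult _ _ _ _ _ (is_derive_PSeries g z H3)
                    (is_derive_PSeries e z H4) Rmult_comm).
    apply is_derive_unique in HD.
    rewrite (Derive_ext_loc _ (fun _ => 1) z) in HD by exact H1.
    rewrite Derive_const in HD. unfold plus, mult in HD; simpl in HD.
    apply locally_singleton in H1.
    set (G := PSeries g z) in *. set (E := PSeries e z) in *.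
    set (G' := PSeries (PS_derive g) z) in *. set (E' := PSeries (PS_derive e) z) in *.
    (* Since G E = 1, also z G' = z (G' E) G = - (z E') G^2. *)
    replace (z * G') with (z * (G' * E) * G)
      by (transitivity (z * G' * (G * E)); [ring|rewrite H1; ring]).
    replace (G' * E) with (- (G * E')) by lra.
    replace (z * - (G * E') * G) with (- (z * E') * (G * G)) by ring.
    rewrite H2.
    replace (- (1 + z * E - E) * (G * G))
      with (- (G * G) - z * G * (G * E) + G * (G * E)) by ring.
    rewrite H1. ring. }
  assert (Hl := expands_incr _ _ (expands_derive _ (PSeries (PS_derive g)) _ Hg
      ltac:(generalize (locally_0_Rbar _ (expands_radius _ _ Hg)); apply filter_imp;
            intros z Hz; now apply is_derive_PSeries))).
  assert (Hr := expands_minus _ _ _ _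
     (expands_minus _ _ _ _ Hg (expands_incr _ _ Hg)) (expands_mult _ _ _ _ Hg Hg)).
  assert (Hr' := expands_ext _ _ _ Hfun Hl).
  exact (expands_unique _ _ _ (S n) Hr' Hr).
Qed.

(** * Quadratic recurrences *)

Lemma bernoulli_coeff_initial (B : nat -> Q) : is_bernoulli B ->
  bernoulli_coeff B 0 = 1 /\ bernoulli_coeff B 1 = - / 2
  /\ bernoulli_coeff B 2 = / 12 /\ bernoulli_coeff B 3 = 0.
Proof.
  intro HB.
  assert (H0 : bernoulli_coeff B 0 = 1)
    by (unfold bernoulli_coeff; destruct HB as [-> _]; simpl; field).
  assert (H1 := bernoulli_riccati B 0 HB).
  assert (H2 := bernoulli_riccati B 1 HB).
  assert (H3 := bernoulli_riccati B 2 HB).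
  unfold PS_mult in *. simpl in *. rewrite H0 in *.
  repeat split; nra.
Qed.

(** In the convolution square the two outer terms on either side involve only
    [g 0 = 1] and [g 1 = - 1 / 2]: the latter cancel the linear term
    [- z * G] and the former combine with the left-hand side. *)
Lemma bernoulli_coeff_shifted_rec (B : nat -> Q) (m : nat) : is_bernoulli B ->
  let q i := bernoulli_coeff B (i + 2) in
  (INR m + 5) * q (m + 2)%nat = - PS_mult q q m.
Proof.
  intros HB q.
  destruct (bernoulli_coeff_initial B HB) as (H0 & H1 & _).
  assert (H := bernoulli_riccati B (m + 3) HB). cbv zeta in H.
  set (g := bernoulli_coeff B) in *.
  replace (S (m + 3)) with (S (S (S (S m)))) in H by lia.
  replace (m + 3)%nat with (S (S (S m))) in H by lia.
  assert (HP : PS_mult g g (S (S (S (S m))))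
    = 2 * g (S (S (S (S m)))) - g (S (S (S m))) + PS_mult q q m).
  { unfold PS_mult. rewrite 2 tech5, 2 decomp_sum by lia. cbn [pred].
    replace (S (S (S (S m))) - S (S (S m)))%nat with 1%nat by lia.
    rewrite Nat.sub_diag. cbn [Nat.sub]. rewrite H0, H1.
    rewrite (sum_eq _ (fun k => q k * q (m - k)%nat)); [lra|].
    intros i Hi. unfold q. rewrite !Nat.add_succ_r, !Nat.add_0_r.
    now replace (S (S (m - i))) with (S (S m) - i)%nat by lia. }
  rewrite HP in H. unfold q at 1.
  replace (m + 2 + 2)%nat with (S (S (S (S m)))) by lia.
  rewrite !S_INR in H. lra.
Qed.

Lemma bernoulli_coeff_odd (B : nat -> Q) (j : nat) : is_bernoulli B ->
  bernoulli_coeff B (2 * j + 3) = 0.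
Proof.
  intro HB. destruct (bernoulli_coeff_initial B HB) as (_ & _ & _ & H3).
  induction j as [j IH] using lt_wf_ind. destruct j as [|j]; [exact H3|].
  assert (H := bernoulli_coeff_shifted_rec B (2 * j + 1) HB). cbv beta zeta in H.
  replace (2 * j + 1 + 2 + 2)%nat with (2 * S j + 3)%nat in H by lia.
  assert (HP : PS_mult (fun i => bernoulli_coeff B (i + 2))
                 (fun i => bernoulli_coeff B (i + 2)) (2 * j + 1) = 0).
  { unfold PS_mult. rewrite <- (Rmult_0_l (INR (S (2 * j + 1)))), <- sum_cte.
    apply sum_eq. intros i Hi.
    destruct (Nat.Even_or_Odd i) as [[k Hk]|[k Hk]].
    - replace (2 * j + 1 - i + 2)%nat with (2 * (j - k) + 3)%nat by lia.
      rewrite (IH (j - k)%nat) by lia. ring.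
    - replace (i + 2)%nat with (2 * k + 3)%nat by lia.
      rewrite (IH k) by lia. ring. }
  rewrite HP in H. assert (Hn := pos_INR (2 * j + 1)).
  apply Rmult_eq_reg_l with (INR (2 * j + 1) + 5); lra.
Qed.

(** These are the numbers [|B_(2j+2)| / (2j+2)!]; the alternating sign makes
    their recurrence free of signs. *)
Definition bernoulli_even_coeff (B : nat -> Q) (j : nat) : R :=
  (-1) ^ j * bernoulli_coeff B (2 * j + 2).

Lemma bernoulli_even_coeff_rec (B : nat -> Q) : is_bernoulli B ->
  let v := bernoulli_even_coeff B in
  v 0%nat = / 12 /\
  forall m, INR (2 * m + 5) * v (S m) = PS_mult v v m.
Proof.
  intros HB v. split.
  - destruct (bernoulli_coeff_initial B HB) as (_ & _ & H2 & _).
    unfold v, bernoulli_even_coeff. simpl. rewrite H2. ring.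
  - intro m. assert (H := bernoulli_coeff_shifted_rec B (2 * m) HB).
    cbv zeta in H. unfold PS_mult in H.
    rewrite sum_even_support in H.
    2:{ intro j. replace (2 * j + 1 + 2)%nat with (2 * j + 3)%nat by lia.
        rewrite bernoulli_coeff_odd by exact HB. ring. }
    unfold v at 1, bernoulli_even_coeff. simpl pow.
    replace (2 * S m + 2)%nat with (2 * m + 2 + 2)%nat by lia.
    rewrite (plus_INR _ 5). replace (INR 5) with 5 by (simpl; ring).
    replace ((INR (2 * m) + 5) * (-1 * (-1) ^ m * bernoulli_coeff B (2 * m + 2 + 2)))
      with (- (-1) ^ m * ((INR (2 * m) + 5) * bernoulli_coeff B (2 * m + 2 + 2))) by ring.
    rewrite H. unfold PS_mult.
    match goal with |- - ?a * - ?b = _ => replace (- a * - b) with (a * b) by ring end.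
    rewrite <- sum_scal_l. apply sum_eq. intros j Hj. unfold v, bernoulli_even_coeff.
    replace (2 * m - 2 * j)%nat with (2 * (m - j))%nat by lia.
    replace ((-1) ^ m) with ((-1) ^ j * (-1) ^ (m - j))
      by (rewrite <- pow_add; f_equal; lia).
    ring.
Qed.

(** The recurrence determines [v] from [v 0], it is stable under multiplication
    of [v j] by [c ^ (j + 1)], and by [node_zeta_convolution] the numbers
    [2 * node_zeta s j] satisfy it.  For the Bernoulli numbers this is Euler's
    formula for [zeta (2 * n)], except for the value of [c] (a rational multiple
    of [1 / PI ^ 2], by the classical evaluation), which is irrelevant for the
    roots. *)
Theorem quadratic_rec_solution (s : nat) (v : nat -> R) : s = 1%nat \/ s = 2%nat ->
  0 < v 0%nat ->
  (forall m, INR (2 * m + 2 * s + 1) * v (S m) = PS_mult v v m) ->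
  exists c, 0 < c /\ forall j, v j = 2 * c ^ S j * node_zeta s j.
Proof.
  intros Hs Hv0 Hv.
  assert (Hz : forall j, 1 <= node_zeta s j) by (intro; apply node_zeta_ge_1; lia).
  assert (Hz0 := Hz 0%nat).
  exists (v 0%nat / (2 * node_zeta s 0)).
  set (c := v 0%nat / (2 * node_zeta s 0)).
  split; [apply Rdiv_lt_0_compat; lra|].
  intro j. induction j as [j IH] using lt_wf_ind. destruct j as [|m].
  - unfold c. simpl. field. lra.
  - assert (Hk : 0 < INR (2 * m + 2 * s + 1)) by (apply lt_0_INR; lia).
    apply Rmult_eq_reg_l with (INR (2 * m + 2 * s + 1)); [|lra].
    rewrite Hv. 
    replace (INR (2 * m + 2 * s + 1) * (2 * c ^ S (S m) * node_zeta s (S m)))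
      with (2 * c ^ S (S m) * (INR (2 * m + 2 * s + 1) * node_zeta s (S m))) by ring.
    rewrite <- node_zeta_convolution by exact Hs.
    unfold PS_mult. rewrite <- Rmult_assoc, <- sum_scal_l.
    apply sum_eq. intros j Hj. rewrite (IH j), (IH (m - j)%nat) by lia.
    replace (S (S m)) with (S j + S (m - j))%nat by lia. rewrite pow_add. ring.
Qed.

(** * Bounds for the slowly varying factors *)

Lemma ln_le_sub_1 (x : R) : 0 < x -> ln x <= x - 1.
Proof.
  intro Hx. rewrite <- (ln_exp (x - 1)). apply ln_le; [exact Hx|].
  assert (H := exp_ineq1_le (x - 1)). lra.
Qed.

Lemma ln_ge_0 (x : R) : 1 <= x -> 0 <= ln x.
Proof. intro H. rewrite <- ln_1. apply ln_le; lra. Qed.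

(** Equality holds at [k = 0]; this is what makes the quadratic weights of
    [root_concavity] harmless against the geometric decay of the corrections. *)
Lemma square_times_quarter_pow (k : nat) :
  (INR k + 3) * (INR k + 4) * (/ 4) ^ S k <= 3.
Proof.
  induction k as [|k IH]; [simpl; lra|].
  rewrite S_INR. change ((/ 4) ^ S (S k)) with (/ 4 * (/ 4) ^ S k).
  assert (Hk := pos_INR k). assert (Hp := pow_lt (/ 4) (S k) ltac:(lra)).
  set (p := (/ 4) ^ S k) in *. nra.
Qed.

Lemma node_zeta_excess (s j : nat) : s = 1%nat \/ s = 2%nat ->
  node_zeta s j <= 1 + 2 / 3 * (/ 4) ^ j.
Proof.
  intro Hs. apply Rle_trans with (1 := node_zeta_le s j ltac:(lia)).
  apply Rplus_le_compat_l. unfold node. change (INR 1) with 1.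
  destruct Hs as [-> | ->]; simpl INR.
  - apply Rmult_le_compat; try lra; [apply pow_le; lra|].
    apply pow_incr. lra.
  - right. f_equal; [lra|]. f_equal. lra.
Qed.

(** The constant factor [2] costs exactly [2 * ln 2].  In the rest, the only
    harmful term is [(n + 1) * (n + 2) * ln (node_zeta s (n - 1))], at most [2]:
    the others add up to something nonnegative because the zeta values decrease
    and are at least [1]. *)
Lemma node_zeta_root_bounds (s n : nat) : s = 1%nat \/ s = 2%nat -> (2 <= n)%nat ->
  let l k := ln (2 * node_zeta s (k - 1)) in
  - (2 * ln 2 + 2) <= root_concavity l n /\ - (2 * ln 2 + 2) <= 2 * root_growth l n.
Proof.
  intros Hs Hn l.
  assert (Hz : forall j, 1 <= node_zeta s j) by (intro; apply node_zeta_ge_1; lia).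
  assert (Hl : forall k, l k = ln 2 + ln (node_zeta s (k - 1))).
  { intro k. unfold l. apply ln_mult; [lra|]. specialize (Hz (k - 1)%nat). lra. }
  set (x := ln (node_zeta s (n - 1))). set (y := ln (node_zeta s n)).
  set (t := ln (node_zeta s (S n))).
  assert (Hx : 0 <= x) by apply ln_ge_0, Hz.
  assert (Hy : 0 <= y) by apply ln_ge_0, Hz.
  assert (Hty : t <= y).
  { apply ln_le; [specialize (Hz (S n)); lra|]. apply node_zeta_decreasing. lia. }
  assert (Hxn : (INR n + 1) * (INR n + 2) * x <= 2).
  { assert (Hxu : x <= 2 / 3 * (/ 4) ^ (n - 1)).
    { apply Rle_trans with (node_zeta s (n - 1) - 1).
      - apply ln_le_sub_1. specialize (Hz (n - 1)%nat). lra.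
      - assert (H := node_zeta_excess s (n - 1) Hs). lra. }
    assert (Hq := square_times_quarter_pow (n - 2)).
    replace (S (n - 2)) with (n - 1)%nat in Hq by lia.
    rewrite minus_INR in Hq by lia. simpl (INR 2) in Hq.
    assert (Hn0 := pos_INR n).
    apply Rle_trans with ((INR n + 1) * (INR n + 2) * (2 / 3 * (/ 4) ^ (n - 1))).
    - apply Rmult_le_compat_l; [nra|exact Hxu].
    - replace (INR n - (1 + 1) + 3) with (INR n + 1) in Hq by ring.
      replace (INR n - (1 + 1) + 4) with (INR n + 2) in Hq by ring.
      nra. }
  apply le_INR in Hn. simpl (INR 2) in Hn.
  unfold root_concavity, root_growth. rewrite !Hl, !S_INR.
  rewrite !Nat.sub_succ, !Nat.sub_0_r. fold x y t.
  split; nra.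
Qed.

(** [exp 1 <= (16 / 15) ^ 16 < 2.81], since [1 - 1 / 16 <= exp (- 1 / 16)]. *)
Lemma one_lt_ln (x : R) : 2.85 <= x -> 1 < ln x.
Proof.
  intro Hx.
  assert (H : / 16 <= ln (16 / 15)).
  { assert (H := ln_le_sub_1 (/ (16 / 15)) ltac:(lra)). rewrite ln_Rinv in H by lra. lra. }
  apply Rle_lt_trans with (ln ((16 / 15) ^ 16)).
  - rewrite ln_pow by lra. replace (INR 16) with 16 by (simpl; ring). lra.
  - apply ln_increasing; [apply pow_lt; lra|]. lra.
Qed.

Lemma ln_smooth_values :
  ln 4 = 2 * ln 2 /\ ln 6 = ln 2 + ln 3 /\ ln 8 = 3 * ln 2.
Proof.
  replace 4 with (2 * 2) by lra. replace 6 with (2 * 3) by lra.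
  replace 8 with (2 * (2 * 2)) by lra. rewrite !ln_mult by lra. lra.
Qed.

Lemma log_fact_0_values :
  log_fact 0 1 = ln 2 /\ log_fact 0 2 = 3 * ln 2 + ln 3
  /\ log_fact 0 3 = 4 * ln 2 + 2 * ln 3 + ln 5
  /\ log_fact 0 4 = 7 * ln 2 + 2 * ln 3 + ln 5 + ln 7.
Proof.
  destruct ln_smooth_values as (H4 & H6 & H8).
  assert (H0 : log_fact 0 0 = 0) by (unfold log_fact; simpl; apply ln_1).
  assert (H1 := log_fact_succ 0 0 ltac:(lia)).
  assert (H2 := log_fact_succ 0 1 ltac:(lia)).
  assert (H3 := log_fact_succ 0 2 ltac:(lia)).
  assert (H5 := log_fact_succ 0 3 ltac:(lia)).
  rewrite !Nat.sub_0_r, !mult_INR, !INR_IZR_INZ in *. simpl (IZR _) in *.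
  replace (2 * 0 + 1) with 1 in H1 by lra. replace (2 * 0 + 2) with 2 in H1 by lra.
  replace (2 * 1 + 1) with 3 in H2 by lra. replace (2 * 1 + 2) with 4 in H2 by lra.
  replace (2 * 2 + 1) with 5 in H3 by lra. replace (2 * 2 + 2) with 6 in H3 by lra.
  replace (2 * 3 + 1) with 7 in H5 by lra. replace (2 * 3 + 2) with 8 in H5 by lra.
  rewrite ln_1 in H1. lra.
Qed.

Lemma log_fact_1_values :
  log_fact 1 2 = ln 2 + ln 3 /\ log_fact 1 3 = 3 * ln 2 + ln 3 + ln 5
  /\ log_fact 1 4 = 4 * ln 2 + 2 * ln 3 + ln 5 + ln 7.
Proof.
  destruct ln_smooth_values as (H4 & H6 & H8).
  assert (H0 : log_fact 1 1 = 0) by (unfold log_fact; simpl; apply ln_1).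
  assert (H2 := log_fact_succ 1 1 ltac:(lia)).
  assert (H3 := log_fact_succ 1 2 ltac:(lia)).
  assert (H5 := log_fact_succ 1 3 ltac:(lia)).
  rewrite !minus_INR, !mult_INR, !INR_IZR_INZ in * by lia. simpl (IZR _) in *.
  replace (2 * 1 - 1 + 1) with 2 in H2 by lra. replace (2 * 1 - 1 + 2) with 3 in H2 by lra.
  replace (2 * 2 - 1 + 1) with 4 in H3 by lra. replace (2 * 2 - 1 + 2) with 5 in H3 by lra.
  replace (2 * 3 - 1 + 1) with 6 in H5 by lra. replace (2 * 3 - 1 + 2) with 7 in H5 by lra.
  lra.
Qed.

(** After exponentiation: [2 ^ 8 * 7 ^ 3 * e < 3 ^ 4 * 5 ^ 5].  The margin is
    under [7] percent. *)
Lemma log_fact_0_concavity_2 : 2 * ln 2 + 2 < root_concavity (log_fact 0) 2.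
Proof.
  destruct log_fact_0_values as (_ & H2 & H3 & H4).
  unfold root_concavity. rewrite H2, H3, H4. simpl INR.
  assert (H := one_lt_ln (3 ^ 4 * 5 ^ 5 / (2 ^ 8 * 7 ^ 3)) ltac:(lra)).
  rewrite ln_div, !ln_mult, !ln_pow, !INR_IZR_INZ in H by lra. simpl (IZR _) in H. lra.
Qed.

(** After exponentiation: [3 ^ 4 * 7 ^ 3 * e < 2 ^ 5 * 5 ^ 5]. *)
Lemma log_fact_1_concavity_2 : 2 * ln 2 + 2 < root_concavity (log_fact 1) 2.
Proof.
  destruct log_fact_1_values as (H2 & H3 & H4).
  unfold root_concavity. rewrite H2, H3, H4. simpl INR.
  assert (H := one_lt_ln (2 ^ 5 * 5 ^ 5 / (3 ^ 4 * 7 ^ 3)) ltac:(lra)).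
  rewrite ln_div, !ln_mult, !ln_pow, !INR_IZR_INZ in H by lra. simpl (IZR _) in H. lra.
Qed.

(** After exponentiation: [5 ^ 2 * e < 3 ^ 4]. *)
Lemma log_fact_0_concavity_1 : 2 * ln (4 / 3) + 1 < root_concavity (log_fact 0) 1.
Proof.
  destruct log_fact_0_values as (H1 & H2 & H3 & _).
  destruct ln_smooth_values as (H4 & _).
  unfold root_concavity. rewrite H1, H2, H3. simpl INR.
  assert (H := one_lt_ln (3 ^ 4 / 5 ^ 2) ltac:(lra)).
  rewrite ln_div, !ln_pow, !INR_IZR_INZ in H by lra. simpl (IZR _) in H.
  rewrite ln_div, H4 by lra. lra.
Qed.

Lemma root_step_1 (x y : R) : x <> 0 -> x * x < Rabs y ->
  abs_root 1 x < abs_root 2 y.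
Proof.
  intros Hx Hxy. unfold abs_root, Rpower. apply exp_increasing.
  assert (Ha := Rabs_pos_lt x Hx).
  assert (H : 2 * ln (Rabs x) < ln (Rabs y)).
  { replace (2 * ln (Rabs x)) with (ln (Rabs x) + ln (Rabs x)) by ring.
    rewrite <- ln_mult, <- Rabs_mult, Rabs_pos_eq by (try assumption; nra).
    apply ln_increasing; [nra|exact Hxy]. }
  simpl INR. lra.
Qed.

(** The criterion applies from [n = 2].  The increase from [n = 1] to [n = 2] is
    read off the first instance of the recurrence,
    [(2 * s + 1) * v 1 = v 0 ^ 2]. *)
Theorem zeta_type_roots (s : nat) (a v : nat -> R) : s = 1%nat \/ s = 2%nat ->
  0 < v 0%nat ->
  (forall m, INR (2 * m + 2 * s + 1) * v (S m) = PS_mult v v m) ->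
  (forall m, Rabs (a (S m)) = INR (fact (2 * S m - (2 - s))) * Rabs (v m)) ->
  increasing_from 1 (fun n => abs_root n (a n)) /\
  decreasing_from 2 (fun n => abs_root (n + 1) (a (n + 1)%nat) / abs_root n (a n)).
Proof.
  intros Hs Hv0 Hv Ha.
  destruct (quadratic_rec_solution s v Hs Hv0 Hv) as (c & Hc & Hsol).
  assert (Hz : forall j, 1 <= node_zeta s j) by (intro; apply node_zeta_ge_1; lia).
  assert (Hvpos : forall j, 0 < v j).
  { intro j. rewrite Hsol. specialize (Hz j). assert (H := pow_lt c (S j) Hc). nra. }
  destruct (root_criterion a (fun n => 2 * node_zeta s (n - 1)) (2 - s) 2 c (2 * ln 2 + 2))
    as [Hinc Hdec]; auto; try lia.
  - intros n Hn. specialize (Hz (n - 1)%nat). lra.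
  - intros n Hn. destruct n as [|m]; [lia|]. rewrite Ha, (Rabs_pos_eq (v _)), Hsol by apply Rlt_le, Hvpos.
    replace (S m - 1)%nat with m by lia. ring.
  - destruct Hs as [-> | ->];
      [exact log_fact_1_concavity_2 | exact log_fact_0_concavity_2].
  - intros n Hn. now apply node_zeta_root_bounds.
  - intros n Hn. now apply node_zeta_root_bounds.
  - split; [|exact Hdec].
    apply increasing_from_step. intros n Hn.
    destruct (Nat.eq_dec n 1) as [->|Hn1]; [|apply Hinc; lia].
    assert (H0 := Ha 0%nat). assert (H1 := Ha 1%nat).
    rewrite (Rabs_pos_eq (v _)) in H0 by apply Rlt_le, Hvpos.
    rewrite (Rabs_pos_eq (v _)) in H1 by apply Rlt_le, Hvpos.
    assert (Hv1 := Hv 0%nat). unfold PS_mult in Hv1. simpl sum_f_R0 in Hv1.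
    apply root_step_1.
    + intro E. rewrite E, Rabs_R0 in H0. assert (Hf := INR_fact_lt_0 (2 * 1 - (2 - s))). nra.
    + rewrite <- (Rabs_pos_eq (a 1%nat * a 1%nat)) by nra. rewrite Rabs_mult, H0, H1.
      destruct Hs as [-> | ->]; simpl in *; nra.
Qed.

Lemma quarter_ninth_convolution (m : nat) :
  / 4 * sum_f_R0 (fun j => (/ 9) ^ j * (/ 4) ^ (m - j)) m <= INR (S m) * (/ 4) ^ S m.
Proof.
  assert (H := geometric_convolution (/ 9) (/ 4) m).
  assert (Hp := pow_lt (/ 4) (S m) ltac:(lra)).
  assert (Hq := pow_lt (/ 9) (S m) ltac:(lra)).
  destruct m as [|m]; [simpl in *; lra|].
  rewrite !S_INR. assert (Hm := pos_INR m). nra.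
Qed.

(** Differencing the recurrence removes the dominant part of [z], the constant
    [1]: the increments [u] (with [u 0 = y 0]) satisfy the same recurrence with
    [z j - 1] in place of [z j].  These weights are nonnegative and decay
    geometrically, hence so do the increments. *)
Lemma linear_rec_increments (z y : nat -> R) :
  y 0%nat = 1 ->
  (forall m, INR (S m) * y (S m) = PS_mult z y m) ->
  (forall j, 1 <= z j <= 1 + / 4 * (/ 9) ^ j) ->
  forall n, 0 <= y (S n) - y n <= (/ 4) ^ S n.
Proof.
  intros Hy0 Hy Hz.
  set (u := fun n => match n with 0%nat => y 0%nat | S k => y (S k) - y k end).
  assert (Hsum : forall n, sum_f_R0 (fun j => u (n - j)%nat) n = y n).
  { induction n as [|n IH]; [reflexivity|].
    rewrite decomp_sum by lia. cbn [pred]. rewrite Nat.sub_0_r.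
    rewrite (sum_eq _ (fun j => u (n - j)%nat)) by reflexivity.
    rewrite IH. simpl. ring. }
  assert (Hu : forall m, INR (S m) * u (S m) = PS_mult (fun j => z j - 1) u m).
  { intro m.
    assert (Hsplit : PS_mult (fun j => z j - 1) u m = PS_mult z u m - y m).
    { rewrite <- Hsum. unfold PS_mult. rewrite <- minus_sum. apply sum_eq. intros; ring. }
    rewrite Hsplit. destruct m as [|p].
    - generalize (Hy 0%nat). unfold PS_mult. simpl. lra.
    - assert (H1 := Hy (S p)). assert (H2 := Hy p).
      assert (H3 : PS_mult z u (S p) = PS_mult z y (S p) - PS_mult z y p).
      { unfold PS_mult. rewrite !tech5, Nat.sub_diag.
        rewrite (sum_eq _ (fun j => z j * y (S p - j)%nat - z j * y (p - j)%nat)).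
        - rewrite minus_sum. simpl u. ring.
        - intros j Hj. replace (S p - j)%nat with (S (p - j)) by lia. simpl. ring. }
      rewrite H3, <- H1, <- H2. simpl u. rewrite !S_INR. ring. }
  assert (Hb : forall n, 0 <= u n <= (/ 4) ^ n).
  { intro n. induction n as [n IH] using lt_wf_ind. destruct n as [|m].
    - simpl. rewrite Hy0. lra.
    - assert (Hm : 0 < INR (S m)) by (apply lt_0_INR; lia).
      split; apply Rmult_le_reg_l with (INR (S m)); try exact Hm; rewrite Hu.
      + rewrite Rmult_0_r. apply sum_nonneg. intros j Hj.
        apply Rmult_le_pos; [specialize (Hz j); lra|]. apply IH. lia.
      + apply Rle_trans with (2 := quarter_ninth_convolution m).
        rewrite <- sum_scal_l. apply sum_Rle. intros j Hj.
        rewrite <- Rmult_assoc.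
        apply Rmult_le_compat; try (apply IH; lia); specialize (Hz j); lra. }
  intro n. exact (Hb (S n)).
Qed.

(** Dividing [e n] by [c ^ n] turns its recurrence into one whose weights are
    the values [node_zeta 1 j], close to [1].  By [linear_rec_increments] the
    quotient [y] increases from [1], by geometrically decaying steps, and stays
    below [4 / 3]; so the criterion applies already from [n = 1]. *)
Theorem secant_type_roots (a w e : nat -> R) :
  0 < w 0%nat ->
  (forall m, INR (2 * m + 3) * w (S m) = PS_mult w w m) ->
  e 0%nat = 1 ->
  (forall m, INR (2 * m + 2) * e (S m) = PS_mult w e m) ->
  (forall n, Rabs (a n) = INR (fact (2 * n)) * Rabs (e n)) ->
  increasing_from 1 (fun n => abs_root n (a n)) /\
  decreasing_from 1 (fun n => abs_root (n + 1) (a (n + 1)%nat) / abs_root n (a n)).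
Proof.
  intros Hw0 Hw He0 He Ha.
  destruct (quadratic_rec_solution 1 w (or_introl eq_refl) Hw0) as (c & Hc & Hsol).
  { intro m. replace (2 * m + 2 * 1 + 1)%nat with (2 * m + 3)%nat by lia. apply Hw. }
  set (y := fun n => e n / c ^ n).
  assert (Hcn : forall n, 0 < c ^ n) by (intro; now apply pow_lt).
  assert (Hinc : forall n, 0 <= y (S n) - y n <= (/ 4) ^ S n).
  { apply linear_rec_increments with (z := node_zeta 1).
    - unfold y. rewrite He0. simpl. field.
    - intro m. unfold y.
      apply Rmult_eq_reg_l with (2 * c ^ S m); [|specialize (Hcn (S m)); lra].
      replace (2 * c ^ S m * (INR (S m) * (e (S m) / c ^ S m)))
        with (INR (2 * m + 2) * e (S m)).
      + rewrite He. unfold PS_mult. rewrite <- sum_scal_l. apply sum_eq. intros j Hj.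
        rewrite Hsol. replace (S m) with (S j + (m - j))%nat at 1 by lia.
        rewrite pow_add. assert (H1 := Hcn (m - j)%nat). field. lra.
      + replace (2 * m + 2)%nat with (2 * S m)%nat by lia. rewrite mult_INR.
        change (INR 2) with 2. specialize (Hcn (S m)). field. lra.
    - intro j. split; [apply node_zeta_ge_1; lia|].
      apply Rle_trans with (1 := node_zeta_le 1 j ltac:(lia)).
      right. unfold node. simpl INR. f_equal. f_equal; [lra|]. f_equal. lra. }
  assert (Hy0 : y 0%nat = 1) by (unfold y; rewrite He0; simpl; field).
  assert (Hy1 : forall n, 1 <= y n).
  { induction n as [|n IH]; [lra|]. specialize (Hinc n). lra. }
  assert (Hy2 : forall n, y n <= 4 / 3 - 1 / 3 * (/ 4) ^ n).
  { induction n as [|n IH]; [rewrite Hy0; simpl; lra|].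
    specialize (Hinc n). simpl pow in *. lra. }
  assert (Hl : forall n, 0 <= ln (y n) <= ln (4 / 3)).
  { intro n. split; [apply ln_ge_0, Hy1|].
    apply ln_le; [specialize (Hy1 n); lra|].
    assert (H := pow_lt (/ 4) n ltac:(lra)). specialize (Hy2 n). lra. }
  assert (Hmono : forall n, 0 <= ln (y (S n)) - ln (y n) <= (/ 4) ^ S n).
  { intro n. specialize (Hinc n). assert (H1 := Hy1 n). assert (H2 := Hy1 (S n)). split.
    - assert (ln (y n) <= ln (y (S n))) by (apply ln_le; lra). lra.
    - rewrite <- ln_div by lra.
      apply Rle_trans with (y (S n) / y n - 1).
      + apply ln_le_sub_1, Rdiv_lt_0_compat; lra.
      + apply Rle_trans with (2 := proj2 Hinc).
        replace (y (S n) / y n - 1) with ((y (S n) - y n) * / y n) by (field; lra).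
        rewrite <- (Rmult_1_r (y (S n) - y n)) at 2.
        apply Rmult_le_compat_l; [lra|]. rewrite <- Rinv_1.
        apply Rinv_le_contravar; lra. }
  apply (root_criterion a y 0 1 c (2 * ln (4 / 3) + 1)); try lia; try exact Hc.
  - intros n _. specialize (Hy1 n). lra.
  - intros n _. rewrite Ha, Nat.sub_0_r.
    assert (E : e n = c ^ n * y n) by (unfold y; field; specialize (Hcn n); lra).
    rewrite E, Rabs_pos_eq; [ring|].
    specialize (Hy1 n). specialize (Hcn n). apply Rmult_le_pos; lra.
  - exact log_fact_0_concavity_1.
  - intros n Hn. unfold root_concavity.
    assert (H0 := Hl n). assert (H1 := Hmono n). assert (H2 := Hmono (S n)).
    assert (Hq := square_times_quarter_pow n).
    change ((/ 4) ^ S (S n)) with (/ 4 * (/ 4) ^ S n) in H2.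
    assert (Hp := pow_lt (/ 4) (S n) ltac:(lra)). assert (Hn0 := pos_INR n).
    set (p := (/ 4) ^ S n) in *. set (l0 := ln (y n)) in *.
    set (l1 := ln (y (S n))) in *. set (l2 := ln (y (S (S n)))) in *.
    assert (Hd : INR n * (INR n + 1) * (l2 - l1) <= 1).
    { apply Rle_trans with (INR n * (INR n + 1) * (/ 4 * p)).
      - apply Rmult_le_compat_l; [nra|lra].
      - nra. }
    nra.
  - intros n Hn. unfold root_growth.
    assert (H0 := Hl n). assert (H1 := Hmono n). rewrite S_INR.
    assert (Hn0 := pos_INR n). nra.
Qed.

Theorem theorem1 (B : nat -> Q) (T E : nat -> R)
  (hB : is_bernoulli B) (hT : is_tangent_numbers T) (hE : is_euler_numbers E) :
  increasing_from 1 (fun n => abs_root n (Q2R (B (2 * n)%nat))) /\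
  increasing_from 1 (fun n => abs_root n (T (2 * n - 1)%nat)) /\
  increasing_from 1 (fun n => abs_root n (E (2 * n)%nat)) /\
  decreasing_from 2 (fun n => abs_root (n + 1) (Q2R (B (2 * n + 2)%nat))
                              / abs_root n (Q2R (B (2 * n)%nat))) /\
  decreasing_from 2 (fun n => abs_root (n + 1) (T (2 * n + 1)%nat)
                              / abs_root n (T (2 * n - 1)%nat)) /\
  decreasing_from 1 (fun n => abs_root (n + 1) (E (2 * n + 2)%nat)
                              / abs_root n (E (2 * n)%nat)).
Proof.
  assert (Habs : forall k j (x : R), Rabs x
            = INR (fact k) * Rabs ((-1) ^ j * x / INR (fact k))).
  { intros k j x. assert (Hf := INR_fact_lt_0 k).
    unfold Rdiv. rewrite !Rabs_mult, pow_1_abs, Rabs_inv, (Rabs_pos_eq (INR _)) by lra.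
    field. lra. }
  destruct (bernoulli_even_coeff_rec B hB) as [Hv0 Hv].
  destruct (zeta_type_roots 2 (fun n => Q2R (B (2 * n)%nat)) (bernoulli_even_coeff B))
    as [HBinc HBdec].
  { now right. }
  { rewrite Hv0. lra. }
  { intro m. replace (2 * m + 2 * 2 + 1)%nat with (2 * m + 5)%nat by lia. apply Hv. }
  { intro m. rewrite (Habs (2 * S m)%nat m), Nat.sub_diag, Nat.sub_0_r.
    unfold bernoulli_even_coeff, bernoulli_coeff.
    replace (2 * S m)%nat with (2 * m + 2)%nat by lia.
    now unfold Rdiv; rewrite Rmult_assoc. }
  set (w := fun k => (-1) ^ (k + 1) * T (2 * k + 1)%nat / INR (fact (2 * k + 1))).
  assert (Htan : expands tan (odd_coeffs w)).
  { apply expands_odd. generalize (proj2 hT). apply filter_imp. intros z Hz.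
    apply is_series_ext with (2 := Hz). intro k. unfold w, Rdiv.
    (* Restates the equation at type [R], where [ring] recognizes it. *)
    apply (f_equal (fun x : R => x)). ring. }
  destruct (tan_coeffs_rec w Htan) as [Hw0 Hw].
  destruct (zeta_type_roots 1 (fun n => T (2 * n - 1)%nat) w) as [HTinc HTdec].
  { now left. }
  { lra. }
  { intro m. replace (2 * m + 2 * 1 + 1)%nat with (2 * m + 3)%nat by lia. apply Hw. }
  { intro m. change (2 - 1)%nat with 1%nat.
    replace (2 * S m - 1)%nat with (2 * m + 1)%nat by lia. apply Habs. }
  set (e := fun k => (-1) ^ k * E (2 * k)%nat / INR (fact (2 * k))).
  assert (Hsec : expands (fun z => / cos z) (even_coeffs e)).
  { apply expands_even. generalize (proj2 hE). apply filter_imp. intros z Hz.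
    apply is_series_ext with (2 := Hz). intro k. unfold e, Rdiv.
    (* Restates the equation at type [R], where [ring] recognizes it. *)
    apply (f_equal (fun x : R => x)). ring. }
  destruct (sec_coeffs_rec w e Htan Hsec) as [He0 He].
  destruct (secant_type_roots (fun n => E (2 * n)%nat) w e) as [HEinc HEdec].
  { lra. }
  { exact Hw. }
  { exact He0. }
  { exact He. }
  { intro n. apply Habs. }
  assert (Heven : forall k, (2 * (k + 1))%nat = (2 * k + 2)%nat) by (intro; lia).
  assert (Hodd : forall k, (2 * (k + 1) - 1)%nat = (2 * k + 1)%nat) by (intro; lia).
  repeat split.
  - exact HBinc.
  - exact HTinc.
  - exact HEinc.
  - intros m n Hm Hmn. rewrite <- !Heven. exact (HBdec m n Hm Hmn).
  - intros m n Hm Hmn. rewrite <- !Hodd. exact (HTdec m n Hm Hmn).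
  - intros m n Hm Hmn. rewrite <- !Heven. exact (HEdec m n Hm Hmn).
Qed.
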